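(* Let $G$ be a word hyperbolic group and let $S$ be any finite generating set of $G$. Let $a_n$ denote the number of elements $g\in G$ whose word length with respect to $S$ is $n$, and let $P_{G,S}(t)=\sum_{n=0}^\infty a_nt^n$. Then the set $\Omega(P_{G,S})$ of opposite series of $P_{G,S}$ is finite.
   Context: Opposite series: let $P(t)=\sum_{n=0}^\infty a_n t^n$ be a power series in $t$ with real coefficients $a_n$, and assume there exist $u,v$ such that $u\le a_{n-1}/a_n\le v$ for all $n$. For each $n\ge 0$ define the polynomial in $s$ $$X_n(P)=\sum_{k=0}^{n}\frac{a_{n-k}}{a_n}s^k .$$ $\Omega(P)$ is the set of accumulation points of the sequence $\{X_n(P)\}_n$ in the set of formal power series in $s$, with respect to the product topology on the coefficients (coefficientwise convergence). An element of $\Omega(P)$ is called an opposite series. Word length with respect to $S$ is the length of a shortest word in $S\cup S^{-1}$ representing the element. *)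

(* Defs.v *)
From mathcomp Require Import all_boot all_order all_algebra.
From mathcomp Require Import finmap.
From mathcomp Require Import all_classical all_reals all_analysis.

Set Implicit Arguments.
Unset Strict Implicit.
Unset Printing Implicit Defensive.

Import Order.TTheory GRing.Theory Num.Theory.
Import numFieldNormedType.Exports.

Local Open Scope classical_set_scope.

Section WordMetric.
Variables (G : groupType) (S : set G).

Definition is_word (w : seq G) : Prop :=
  forall x, x \in w -> S x \/ S (x^-1)%g.

Definition represented_in (g : G) (n : nat) : Prop :=
  exists w : seq G, [/\ is_word w, size w = n & (\prod_(x <- w) x)%g = g].

Definition generating : Prop := forall g : G, exists n, represented_in g n.

(* [xget] returns the default 0 only when no word represents [g], which does
   not happen if [S] is generating. *)
Definition word_length (g : G) : nat :=
  xget 0%N [set n | represented_in g n /\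
                    forall m, represented_in g m -> (n <= m)%N].

Definition word_dist (g h : G) : nat := word_length (g^-1 * h)%g.

(* [fset_set] is the empty set on infinite sets; spheres are finite as soon as
   [S] is finite and generating. *)
Definition sphere_card (n : nat) : nat :=
  #|` fset_set [set g : G | word_length g = n] |.

End WordMetric.

Local Open Scope ring_scope.

Definition gromov_product (R : realType) (T : Type) (d : T -> T -> R)
    (p x y : T) : R :=
  (d x p + d y p - d x y) / 2.

Definition gromov_hyperbolic (R : realType) (T : Type) (d : T -> T -> R) :
    Prop :=
  exists delta : R, forall p x y z : T,
    Num.min (gromov_product d p x y) (gromov_product d p y z) - delta
      <= gromov_product d p x z.

(* Gromov's definition: the group with the word metric of some finite
   generating set is a hyperbolic metric space. *)
Definition word_hyperbolic (R : realType) (G : groupType) : Prop :=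
  exists S : set G, [/\ finite_set S, generating S &
    gromov_hyperbolic (fun g h : G => (word_dist S g h)%:R : R)].

Definition growth_series (R : realType) (G : groupType) (S : set G) :
    nat -> R :=
  fun n => (sphere_card S n)%:R.

(* Formal power series are represented by their coefficient sequences. *)
Section OppositeSeries.
Variables (R : realType) (a : nat -> R).

Definition opposite_poly (n : nat) : {poly R} :=
  \poly_(k < n.+1) (a (n - k)%N / a n).

Definition opposite_seq (n : nat) : {ptws nat -> R} :=
  fun k => (opposite_poly n)`_k.

(* Cluster points of the sequence: values repeated infinitely often count.
   Where [a n = 0], [opposite_poly n] is 0 by the convention [x / 0 = 0]. *)
Definition opposite_series : set {ptws nat -> R} :=
  cluster (opposite_seq n @[n --> \oo]).

End OppositeSeries.

(* Main.v *)
Require Import Defs.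
From mathcomp Require Import all_boot all_order all_algebra.
From mathcomp Require Import finmap complex.
From mathcomp Require Import all_classical all_reals all_analysis.
From mathcomp Require Import zify ring lra.

(* Change of generators: geodesics for [S] are quasi-geodesics for the word
   metric [S0] that is assumed hyperbolic, so by the Morse lemma geodesics for
   [S] from 1 with neighbouring endpoints fellow-travel. As Cannon observed, this
   leaves finitely many cone types; here the type of [g] also records the cones
   of the elements at the level of [g] that share a descendant with [g], which
   makes it determine the types of the successors of [g] and how many
   predecessors each of them has. Dividing by this number of predecessors gives
   a nonnegative real matrix [A] (with no uniqueness of normal forms needed) and
   vectors [x n] with [x n.+1 = x n *m A] whose entries sum to [a n].

   Every eigenvalue of maximal modulus [lambda] of a nonnegative matrix of size
   [N] satisfies [mu ^+ P = lambda ^+ P] with [P = N`!]. By Cayley-Hamilton,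
   along each residue class modulo [P] some iterated difference of
   [a n / lambda ^+ n] decays exponentially, so that the sequence itself is
   asymptotic to a multiple of a binomial coefficient ['C(m, d)]; the degree [d]
   is the same for all classes since [a n.+1 <= B * a n]. Hence
   [a (n - k) / a n] converges along each class, and there are at most [P]
   opposite series. *)

Set Implicit Arguments.
Unset Strict Implicit.
Unset Printing Implicit Defensive.

Import Order.TTheory GRing.Theory Num.Theory.
Import numFieldNormedType.Exports.

(** * Stability of quasi-geodesics *)

Section Morse.
Local Open Scope nat_scope.
Variables (T : Type) (d : T -> T -> nat) (D : nat).
Hypothesis dC : forall x y, d x y = d y x.
Hypothesis dxx : forall x, d x x = 0.
Hypothesis d_tri : forall y x z, d x z <= d x y + d y z.
Hypothesis four_point : forall p x y z,
  d x z + d y p <= maxn (d x y + d z p) (d y z + d x p) + D.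

(* Halving the path [k] times by [four_point] costs [k * D]: the Gromov product
   of the endpoints only drops logarithmically in the length of the path. *)
Lemma path_product_pow2 k L M p (f : nat -> T) :
  (forall i, d (f i) (f i.+1) <= L) -> (forall i, M <= d p (f i)) ->
  d (f 0) (f (2 ^ k)) + 2 * M <= d (f 0) p + d (f (2 ^ k)) p + L + k * D.
Proof.
move=> stepf; elim: k f stepf => [|k IH] f stepf farf.
  have := stepf 0; have := farf 0; have := farf 1.
  by rewrite expn0 (dC p) (dC p (f 0)); lia.
have IH1 := IH f stepf farf.
have := IH (fun i => f (2 ^ k + i)) _ (fun i => farf _).
rewrite addn0 addnn -mul2n -expnS => /(_ _)/wrap[i|IH2]; first by rewrite addnS.
have := four_point p (f 0) (f (2 ^ k)) (f (2 ^ k.+1)).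
by rewrite mulSn; lia.
Qed.

(** The path is prolonged by resting at its last point, so that its length becomes the power of two
    needed for halving. *)
Lemma path_product n k L M p (f : nat -> T) :
  n <= 2 ^ k ->
  (forall i, i < n -> d (f i) (f i.+1) <= L) ->
  (forall i, i <= n -> M <= d p (f i)) ->
  d (f 0) (f n) + 2 * M <= d (f 0) p + d (f n) p + L + k * D.
Proof.
move=> nk stepf farf.
have := @path_product_pow2 k L M p (fun i => f (minn i n)).
rewrite min0n (minn_idPr nk); apply=> i /=; last by apply: farf; lia.
case: (ltnP i n) => [lt_in|le_ni].
  by rewrite (minn_idPl lt_in) stepf.
by rewrite (minn_idPr (leqW le_ni)) dxx.
Qed.

(** The lower bound is written without division. The upper bound carries no additive error, so
    consecutive points are at most [L] apart. *)
Definition quasi_geodesic L C n (f : nat -> T) :=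
  forall i j, i <= j <= n -> d (f i) (f j) <= L * (j - i) /\ j - i <= L * d (f i) (f j) + C.

(** A quasi-geodesic takes at most [L * d (f i) (f j) + C] steps between two of its points, so the
    logarithmic loss is governed by their distance and not by [n]. *)
Lemma quasi_geodesic_product L C n k M p f i j :
  quasi_geodesic L C n f -> i <= n -> j <= n ->
  (forall i, i <= n -> M <= d p (f i)) ->
  L * d (f i) (f j) + C <= 2 ^ k ->
  d (f i) (f j) + 2 * M <= d (f i) p + d (f j) p + L + k * D.
Proof.
move=> qf; wlog le_ij : i j / i <= j => [IH|] lein lejn farf lek.
  case: (leqP i j) => [le_ij|/ltnW le_ji]; first exact: IH.
  by have := IH j i le_ji lejn lein farf; rewrite dC; lia.
have := @path_product (j - i) k L M p (fun t => f (i + t)).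
rewrite addn0 subnKC //; apply.
- by have := qf i j; lia.
- by move=> t lt_t; have := qf (i + t) (i + t.+1); rewrite -[leqRHS]muln1; lia.
- by move=> t le_t; apply: farf; lia.
Qed.

Lemma linear_lt_exp b c : exists k0, forall k, k0 <= k -> b * k + c < 2 ^ k.
Proof.
have sq k : k * k <= 2 ^ k.+1.
  elim: k => // k IH; case: (leqP k 2) => [le_k2|k3].
    by have [->|[->|->]] : k = 0 \/ k = 1 \/ k = 2 by lia.
  by rewrite expnS; nia.
exists (2 * b + 2 * c + 2)%N => k lek.
have := sq k; rewrite expnS => sqk.
have : (2 * b + 2 * c + 2) * k <= k * k by rewrite leq_mul2r lek orbT.
nia.
Qed.

(** Let [q i0] be the point of the geodesic farthest from the path, at distance [M]. The path joins
    points close to both sides of [q i0] while staying [M] away from it; the product estimate then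
    bounds [M] by a logarithm of a linear function of [M]. *)
Lemma geodesic_near_quasi_geodesic L C : exists K, forall n m f q,
  quasi_geodesic L C n f -> (forall i j, i <= j <= m -> d (q i) (q j) = j - i) ->
  q 0 = f 0 -> q m = f n ->
  forall i, i <= m -> exists2 j, j <= n & d (q i) (f j) <= K.
Proof.
(* Beyond [k0], [2 ^ k] exceeds the bound on [2 * (6 * L * M + C)] that follows from
   [2 * M <= L + (k + 2) * D]; the logarithm [k] chosen below must therefore be smaller than
   [k0]. *)
have [k0 k0P] := linear_lt_exp (6 * L * D) (6 * L * (L + 2 * D) + 2 * C + 2).
exists (L + (k0 + 2) * D) => n m f q qf geoq q0 qm.
pose near i := [arg min_(j < (ord0 : 'I_n.+1)) d (q i) (f j)].
pose dist i := d (q i) (f (near i)).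
have dist_le i j : j <= n -> dist i <= d (q i) (f j).
  rewrite -ltnS /dist /near => ltj; case: arg_minnP => // j0 _ minj0.
  exact: (minj0 (Ordinal ltj)).
have distP i : exists2 j, j <= n & d (q i) (f j) = dist i.
  by exists (near i) => //; rewrite -ltnS.
have [i0 _ maxi0] := @arg_maxnP 'I_m.+1 ord0 xpredT (fun i => dist i) isT.
set M := dist i0 in maxi0.
have le_i0 : i0 <= m by rewrite -ltnS.
have distM i : i <= m -> dist i <= M by rewrite -ltnS => lti; exact: (maxi0 (Ordinal lti)).
suff leM : M <= L + (k0 + 2) * D.
  move=> i lei; have [j lej ej] := distP i; exists j => //.
  by rewrite ej (leq_trans _ leM) ?distM.
(* On either side of [i0], a point at distance [2 M] from [q i0], or an end. *)
have farf j : j <= n -> M <= d (q i0) (f j) by exact: dist_le.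
have left : exists i j, [/\ i <= i0, j <= n, d (q i) (q i0) <= 2 * M,
    d (q i) (f j) <= M & d (q i) (f j) + 2 * M <= d (q i) (q i0) + d (f j) (q i0)].
  case: (leqP (2 * M) i0) => [le2M|/ltnW le2M].
    have [j lej ej] := distP (i0 - 2 * M); have := distM (i0 - 2 * M).
    have := geoq (i0 - 2 * M) i0; have := farf j lej.
    by exists (i0 - 2 * M), j; rewrite (dC (f j)); split=> //; lia.
  exists 0, 0; have := geoq 0 i0; have := farf 0; rewrite (dC _ (f 0)) -q0 dxx.
  by split=> //; lia.
have right : exists i j, [/\ i0 <= i <= m, j <= n, d (q i) (q i0) <= 2 * M,
    d (q i) (f j) <= M & d (q i) (f j) + 2 * M <= d (q i) (q i0) + d (f j) (q i0)].
  case: (leqP (i0 + 2 * M) m) => [le2M|/ltnW le2M].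
    have [j lej ej] := distP (i0 + 2 * M); have := distM (i0 + 2 * M) le2M.
    have := geoq i0 (i0 + 2 * M); have := farf j lej.
    by exists (i0 + 2 * M), j; rewrite (dC (f j)) (dC _ (q i0)); split=> //; lia.
  exists m, n; have := geoq i0 m; have := farf n; rewrite (dC _ (f n)) -qm dxx (dC (q m)).
  by split=> //; lia.
case: left => i1 [j1 [le_i1 le_j1 near1 closei1 prod1]].
case: right => i2 [j2 [/andP[le_i2 le_i2m] le_j2 near2 closei2 prod2]].
(* By the triangle inequality [f j1] and [f j2] are at most [M + 4 * M + M] apart. *)
set k := up_log 2 (6 * L * M + C).
have lek : 6 * L * M + C <= 2 ^ k by exact: up_logP.
have prodf : d (f j1) (f j2) + 2 * M <= d (f j1) (q i0) + d (f j2) (q i0) + L + k * D.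
  apply: (quasi_geodesic_product qf) => //; apply: leq_trans lek; rewrite leq_add2r -mulnA mulnCA.
  rewrite leq_mul2l; apply/orP; right.
  have := d_tri (q i1) (f j1) (f j2); have := d_tri (q i2) (q i1) (f j2).
  have := d_tri (q i0) (q i1) (q i2).
  by rewrite (dC (f j1) (q i1)) (dC (q i0)); lia.
have := four_point (q i0) (q i1) (f j1) (f j2).
have := four_point (q i0) (q i1) (f j2) (q i2).
have := geoq i1 i2; have := geoq i1 i0; have := geoq i0 i2.
rewrite (dC (f j2) (q i2)) (dC (q i0) (q i2)) => g1 g2 g3 fp1 fp2.
(* At [q i0] the Gromov product of [q i1] and [q i2] is 0. Passing through [f j1] and [f j2] bounds
   it from below, at the price of two uses of [four_point]. *)
have boundM : 2 * M <= L + (k + 2) * D by rewrite mulnDl; lia.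
case: (leqP k0 k) => [/k0P ltk|ltk]; last first.
  by have : (k + 2) * D <= (k0 + 2) * D; [rewrite leq_mul2r; lia|lia].
case: (leqP (6 * L * M + C) 1) => [le1|gt1].
  have k_eq0 : k = 0 by apply/eqP; rewrite up_log_eq0 orbC le1.
  by move: ltk; rewrite k_eq0 expn0; lia.
have ltk' := up_log_gtn (isT : 1 < 2) gt1.
have k_gt0 : 0 < k by rewrite up_log_gt0.
move: ltk' ltk; rewrite -/k -{3}(prednK k_gt0) expnS => ltk' ltk.
have : 6 * L * (2 * M) <= 6 * L * (L + (k + 2) * D) by rewrite leq_mul2l boundM orbT.
have -> : 6 * L * (L + (k + 2) * D) = 6 * L * D * k + 6 * L * (L + 2 * D) by lia.
by lia.
Qed.

(** Take the first [i] such that [q i] is near some [f s] with [t <= s]. The preceding point of [q]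
    is near some [f s''] with [s'' <= t], so [f s''] and [f s] are at most [2 * K + 1] apart, whence
    [s - s''] is bounded and [f t] is close to [q i], which is near [f']. *)
Lemma quasi_geodesics_close L C : exists K, forall n n' m f f' q,
  quasi_geodesic L C n f -> quasi_geodesic L C n' f' ->
  (forall i j, i <= j <= m -> d (q i) (q j) = j - i) ->
  q 0 = f 0 -> q m = f n -> q 0 = f' 0 -> q m = f' n' ->
  forall t, t <= n -> exists2 s, s <= n' & d (f t) (f' s) <= K.
Proof.
have [K KP] := geodesic_near_quasi_geodesic L C.
exists (L * (L * (2 * K + 1) + C) + K + K) => n n' m f f' q qf qf' geoq q0 qm q0' qm' t let_n.
have ex_i : exists i, (i <= m) && [exists s : 'I_n.+1, (t <= s) && (d (q i) (f s) <= K)].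
  exists m; rewrite leqnn; apply/existsP; exists ord_max => /=.
  by rewrite let_n qm dxx.
case: (ex_minnP ex_i) => i /andP[leim /existsP[s /andP[le_ts close_s]]] mini.
have les : s <= n by rewrite -ltnS.
have [s' les' close_s'] := KP n' m f' q qf' geoq q0' qm' i leim.
exists s' => //.
have [s'' [le_s'' close_s'']] : exists s'', s'' <= t /\ d (f s'') (f s) <= 2 * K + 1.
  case: i => [|i] in leim close_s mini close_s' *.
    by exists 0; rewrite -q0; split => //; lia.
  have [s'' les'' close_s''] := KP n m f q qf geoq q0 qm i (ltnW leim).
  exists s''; split; last first.
    have := geoq i i.+1; have := d_tri (q i) (f s'') (f s); have := d_tri (q i.+1) (q i) (f s).
    by rewrite (dC (f s'') (q i)); lia.
  case: (leqP s'' t) => // lt_t; have := mini i; rewrite (ltnW leim) /= ltnn.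
  case: existsP => [_ /(_ isT)//|[]]; exists (Ordinal (les'' : s'' < n.+1)) => /=.
  by rewrite (ltnW lt_t).
have [_ ] := qf s'' s ltac:(lia); have [] := qf t s ltac:(lia) => Hts _ Hs.
have : L * (s - t) <= L * (s - s'') by rewrite leq_mul2l; lia.
have : L * d (f s'') (f s) <= L * (2 * K + 1) by rewrite leq_mul2l close_s'' orbT.
move=> H1 H2; have : L * (s - s'') <= L * (L * (2 * K + 1) + C) by rewrite leq_mul2l; lia.
have := d_tri (f s) (f t) (f' s'); have := d_tri (q i) (f s) (f' s').
rewrite (dC (f s) (q i)); lia.
Qed.

End Morse.

(** * Word lengths and fellow travelers *)

Section WordLength.
Local Open Scope classical_set_scope.
Local Open Scope nat_scope.
Local Open Scope group_scope.
Variables (G : groupType) (S : set G).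
Hypothesis genS : generating S.
Local Notation l := (word_length S).

Lemma word_lengthP g :
  represented_in S g (l g) /\ forall m, represented_in S g m -> l g <= m.
Proof.
rewrite /word_length; case: xgetP => [n _ //|none].
have ex_n : exists n, `[< represented_in S g n >].
  by have [n repn] := genS g; exists n; apply/asboolP.
case: (ex_minnP ex_n) => n /asboolP repn minn.
by case: (none n); split=> // m repm; apply/minn/asboolP.
Qed.

Lemma word_length_le g n : represented_in S g n -> l g <= n.
Proof. by move=> repn; have [_] := word_lengthP g; apply. Qed.

Lemma word_length1 : l 1 = 0.
Proof.
apply/eqP; rewrite -leqn0 word_length_le //; exists [::].
by split=> //; rewrite big_nil.
Qed.

Lemma word_length_eq0 g : l g = 0 -> g = 1.
Proof.
move=> lg0; have [[[|x u] [_ + <-]] _] := word_lengthP g; first by rewrite big_nil.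
by rewrite lg0.
Qed.

Lemma word_length_prod w : is_word S w -> l (\prod_(x <- w) x) <= size w.
Proof. by move=> ww; apply: word_length_le; exists w. Qed.

Lemma word_lengthM g h : l (g * h) <= l g + l h.
Proof.
have [[u [wu su gE]] _] := word_lengthP g; have [[v [wv sv hE]] _] := word_lengthP h.
rewrite -su -sv -size_cat -gE -hE -big_cat; apply: word_length_prod.
by move=> x; rewrite mem_cat => /orP[/wu|/wv].
Qed.

Lemma word_lengthV_le g : l g^-1 <= l g.
Proof.
have [[u [wu su gE]] _] := word_lengthP g.
apply: word_length_le; exists (rev [seq x^-1 | x <- u]); split.
- move=> x; rewrite mem_rev => /mapP[y /wu Sy ->].
  by rewrite invgK; case: Sy; [right|left].
- by rewrite size_rev size_map.
rewrite -gE; elim: u {wu su gE} => [|x u IH]; first by rewrite !big_nil invg1.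
by rewrite /= rev_cons big_rcons /= IH big_cons invgM.
Qed.

Lemma word_lengthV g : l g^-1 = l g.
Proof. by apply/eqP; rewrite eqn_leq word_lengthV_le -{1}[g]invgK word_lengthV_le. Qed.

Lemma word_length_le1 g : l g <= 1%N -> [\/ g = 1, S g | S g^-1].
Proof.
have [[u [wu <- <-]] _] := word_lengthP g.
case: u wu => [|x [|//]] wu _; first by constructor 1; rewrite big_nil.
by rewrite big_seq1; case: (wu x (mem_head _ _)); [constructor 2|constructor 3].
Qed.

Lemma word_distC g h : word_dist S g h = word_dist S h g.
Proof. by rewrite /word_dist -word_lengthV invgM invgK. Qed.

Lemma word_distxx g : word_dist S g g = 0.
Proof. by rewrite /word_dist mulVg word_length1. Qed.

Lemma word_dist_triangle h g k : word_dist S g k <= word_dist S g h + word_dist S h k.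
Proof. by have := word_lengthM (g^-1 * h) (h^-1 * k); rewrite -mulgA mulVKg. Qed.

Lemma word_length_le_dist g h : l h <= l g + word_dist S g h.
Proof. by have := word_lengthM g (g^-1 * h); rewrite mulVKg. Qed.

Lemma word_dist1 g : word_dist S 1 g = l g.
Proof. by rewrite /word_dist invg1 mul1g. Qed.

Lemma word_dist_mull g h k : word_dist S (g * h) (g * k) = word_dist S h k.
Proof. by rewrite /word_dist invgM -mulgA mulKg. Qed.

Lemma word_dist_mulr g h : word_dist S g (g * h) = l h.
Proof. by rewrite /word_dist mulKg. Qed.

Lemma word_length_prefix g k :
  k <= l g -> exists2 p, l p = k & word_dist S p g = l g - k.
Proof.
move=> lek; have [[u [wu su gE]] _] := word_lengthP g.
pose p := \prod_(x <- take k u) x.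
have lp : l p <= k.
  rewrite -[leqRHS](@size_takel k _ u) ?su //.
  by apply: word_length_prod => x /mem_take/wu.
have lpg : word_dist S p g <= l g - k.
  rewrite /word_dist -gE -{1}(cat_take_drop k u) big_cat mulKg gE -su -size_drop.
  by apply: word_length_prod => x /mem_drop/wu.
by have := word_length_le_dist p g; exists p; lia.
Qed.

(** By hypothesis shortest words for [p] and [p^-1 * x] concatenate to a shortest word for [x]; [f]
    runs through its prefixes. *)
Lemma word_length_geodesic p x : l p + word_dist S p x = l x ->
  exists f : nat -> G, [/\ f 0 = 1, f (l p) = p, f (l x) = x &
    forall i j, i <= j <= l x -> word_dist S (f i) (f j) = j - i].
Proof.
move=> lpx.
have [[u [wu su uE]] _] := word_lengthP p.
have [[v [wv sv vE]] _] := word_lengthP (p^-1 * x).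
pose w := u ++ v.
have ww : is_word S w by move=> y; rewrite mem_cat => /orP[/wu|/wv].
have sw : size w = l x by rewrite size_cat su sv.
have wE : \prod_(y <- w) y = x by rewrite big_cat /= uE vE mulVKg.
pose f i := \prod_(y <- take i w) y.
have fE i j : i <= j -> (f i)^-1 * f j = \prod_(y <- take (j - i) (drop i w)) y.
  by move=> le_ij; rewrite /f -{1}(subnKC le_ij) takeD big_cat mulKg.
have f_lip i j : i <= j -> word_dist S (f i) (f j) <= j - i.
  move=> le_ij; rewrite /word_dist fE // (leq_trans (word_length_prod _)) //.
    by move=> y /mem_take/mem_drop/ww.
  by rewrite size_take_min geq_minl.
have f0 : f 0 = 1 by rewrite /f take0 big_nil.
have fx : f (l x) = x by rewrite /f -sw take_size.
exists f; split=> //; first by rewrite /f -su /w take_size_cat.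
move=> i j /andP[le_ij le_jx].
have := f_lip i j le_ij; have := f_lip j (l x) le_jx; have := f_lip 0 i (leq0n i).
have := word_length_le_dist (f i) (f j); have := word_length_le_dist (f j) (f (l x)).
by rewrite f0 fx word_dist1; lia.
Qed.

Lemma finite_ball (finS : finite_set S) n : finite_set [set g | l g <= n].
Proof.
have fin1 : finite_set [set g | l g <= 1%N].
  apply: (@sub_finite_set _ _ ([set 1] `|` (S `|` (fun x => x^-1) @` S))).
    move=> g /word_length_le1[-> | | SgV]; [by left|by right; left|].
    by right; right; exists g^-1 => //; rewrite invgK.
  by rewrite !finite_setU; split=> //; split=> //; exact: finite_image.
elim: n => [|n IH].
  by apply: sub_finite_set fin1 => g /=; lia.
apply: (@sub_finite_set _ _ [set g * h | g in [set g | l g <= n] & h in [set h | l h <= 1%N]]).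
  move=> g /= leg; case: (leqP (l g) n) => [leg'|gtg].
    by exists g => //; exists 1; rewrite ?mulg1 //= word_length1.
  have [p lp lpg] := word_length_prefix (ltnW gtg).
  exists p; first by rewrite /= lp.
  by exists (p^-1 * g); [rewrite /= -/(word_dist S p g); lia|rewrite mulVKg].
exact: finite_image2.
Qed.

End WordLength.

Section ChangeGenerators.
Local Open Scope classical_set_scope.
Local Open Scope nat_scope.
Local Open Scope group_scope.
Variables (G : groupType).

Lemma finite_nat_bounded (T : choiceType) (A : set T) (f : T -> nat) :
  finite_set A -> exists L, forall x, A x -> f x <= L.
Proof.
move=> finA; exists (\max_(x <- fset_set A) f x) => x Ax.
by apply: leq_bigmax_seq => //; rewrite in_fset_set // inE.
Qed.

Lemma word_length_lipschitz (S S' : set G) :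
  finite_set S -> generating S -> generating S' ->
  exists L, forall g, word_length S' g <= (L * word_length S g)%N.
Proof.
move=> finS genS genS'.
have [L LP] := finite_nat_bounded (word_length S') (finite_ball genS finS 1%N).
exists L => g; elim: {g}(word_length S g) {-2}g (erefl (word_length S g)) => [|n IH] g lg.
  by rewrite (word_length_eq0 genS lg) word_length1.
have [|p lp lpg] := @word_length_prefix _ _ genS g n; first by rewrite lg.
have := word_lengthM genS' p (p^-1 * g); rewrite mulVKg => leM.
have := IH p lp; have := LP (p^-1 * g).
by rewrite /= -/(word_dist S p g) lpg lg lp mulnS; lia.
Qed.

End ChangeGenerators.

Section FellowTraveler.
Local Open Scope classical_set_scope.
Local Open Scope nat_scope.
Local Open Scope group_scope.
Variables (G : groupType) (S0 S : set G) (D : nat).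
Hypothesis (finS0 : finite_set S0) (genS0 : generating S0).
Hypothesis (finS : finite_set S) (genS : generating S).
Local Notation d0 := (word_dist S0).
Local Notation d := (word_dist S).
Local Notation l := (word_length S).
Hypothesis four_point : forall p x y z,
  d0 x z + d0 y p <= maxn (d0 x y + d0 z p) (d0 y z + d0 x p) + D.

Lemma fellow_traveler : exists K, forall x y p q,
  d x y <= 1%N -> l p + d p x = l x -> l q + d q y = l y -> l p = l q ->
  d p q <= K.
Proof.
have [L1 L1P] := word_length_lipschitz finS genS genS0.
have [L2 L2P] := word_length_lipschitz finS0 genS0 genS.
pose L := L1 + L2.
have d0_le g h : d0 g h <= (L * d g h)%N by have := L1P (g^-1 * h); rewrite /word_dist /L; nia.
have d_le g h : d g h <= (L * d0 g h)%N by have := L2P (g^-1 * h); rewrite /word_dist /L; nia.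
have [K KP] := @quasi_geodesics_close _ d0 D (word_distC genS0) (word_distxx genS0)
  (word_dist_triangle genS0) four_point L 2.
exists (2 * (L * K) + 2)%N => x y p q dxy px qy lpq.
have [f [f0 fp fx geof]] := word_length_geodesic genS px.
have [g [g0 gq gy geog]] := word_length_geodesic genS qy.
have [|h [h0 _ hx geoh]] := @word_length_geodesic _ _ genS0 1 x.
  by rewrite word_length1 // word_dist1.
(* The geodesic to [y] is prolonged by a step to [x], so that both paths have the same ends; this
   accounts for the additive constant 2. *)
pose g' i := if i <= l y then g i else x.
have qf : quasi_geodesic d0 L 2 (l x) f.
  move=> i j leij; have := geof i j leij; have := d0_le (f i) (f j).
  by have := d_le (f i) (f j) => + + <-; lia.
have qg' : quasi_geodesic d0 L 2 (l y).+1 g'.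
  move=> i j /andP[leij lejy]; suff : d (g' i) (g' j) <= j - i <= d (g' i) (g' j) + 2.
    by have := d0_le (g' i) (g' j); have := d_le (g' i) (g' j); nia.
  rewrite /g'; case: (leqP j (l y)) => [lej|gtj].
    by rewrite (leq_trans leij lej) geog ?leij //; lia.
  case: (leqP i (l y)) => [lei|gti]; last by rewrite word_distxx //; lia.
  have := geog i (l y); rewrite gy => geoi.
  have := word_dist_triangle genS y (g i) x; have := word_dist_triangle genS x (g i) y.
  by rewrite (word_distC genS y x); lia.
have lp : l p <= l x by lia.
have [||||s les] := KP _ _ _ f g' h qf qg' geoh _ _ _ _ (l p) lp.
- by rewrite h0 f0.
- by rewrite hx fx.
- by rewrite h0 /g' g0.
- by rewrite hx /g' ltnn.
(* The point [g' s] near [p] need not lie at the level of [p]. Comparing lengths bounds the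
   difference of levels by about [L * K], which doubles the constant. *)
rewrite fp => near_s; have := d_le p (g' s).
have : L * d0 p (g' s) <= L * K by rewrite leq_mul2l near_s orbT.
rewrite /g'; case: (leqP s (l y)) => [les'|gts] leK dps.
  have [gs ls] : d (g s) q <= (l q - s) + (s - l q) /\ d 1 (g s) = s.
    split; last by rewrite -g0 geog; lia.
    rewrite -{1}gq; case: (leqP s (l q)) => [le|/ltnW le].
      by rewrite geog; lia.
    by rewrite word_distC // geog; lia.
  have {}ls : l (g s) = s by rewrite -[RHS]ls word_dist1.
  have := word_dist_triangle genS (g s) p q.
  have := word_length_le_dist genS p (g s); have := word_length_le_dist genS (g s) p.
  by rewrite (word_distC genS (g s) p); lia.
have := word_dist_triangle genS x p q; have := word_dist_triangle genS y x q.
have := word_length_le_dist genS y x; have := word_length_le_dist genS x y.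
by rewrite (word_distC genS y x) (word_distC genS y q); lia.
Qed.

End FellowTraveler.

(** * Cone types *)

Section FiniteSets.
Local Open Scope classical_set_scope.

Lemma finite_set_subsets (T : choiceType) (A : set T) :
  finite_set A -> finite_set [set B | B `<=` A].
Proof.
move=> finA; apply: (@sub_finite_set _ _
    ((fun X : {fset T} => [set` X]) @` [set` fpowerset (fset_set A)])).
  move=> B subBA /=; have finB := sub_finite_set subBA finA.
  exists (fset_set B); rewrite ?fset_setK //= fpowersetE.
  by apply/fsubsetP => x; rewrite !in_fset_set // !inE; exact: subBA.
exact: finite_image.
Qed.

Lemma finite_range_factor (T : choiceType) (U V : Type) (f : T -> U) (c : T -> V) :
  finite_set (range f) -> (forall x y, f x = f y -> c x = c y) -> finite_set (range c).
Proof.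
move=> finf fc; have [[x0 _]|T0] := pselect (exists x : T, True); last first.
  by apply: (@sub_finite_set _ _ set0) => // y [x _ _]; case: T0; exists x.
pose rep y := xget x0 [set x | f x = y].
apply: (@sub_finite_set _ _ ((fun y => c (rep y)) @` range f)).
  move=> _ [x _ <-]; exists (f x); first by exists x.
  by apply: fc; rewrite /rep; case: xgetP => [y _ //|/(_ x)[]].
exact: finite_image.
Qed.

Lemma finite_range_index (T : Type) (U : choiceType) (c : T -> U) (x0 : T) :
  finite_set (range c) -> exists N (kappa : T -> 'I_N.+1),
    (forall x y, kappa x = kappa y -> c x = c y) /\
    (forall x y, c x = c y -> kappa x = kappa y) /\
    forall i, exists x, kappa x = i.
Proof.
move=> finc; pose X : seq U := fset_set (range c).
have cX x : c x \in X by rewrite in_fset_set // inE; exists x.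
have X_gt0 : (0 < size X)%N by case: X cX => // /(_ x0).
exists (size X).-1, (fun x => inord (index (c x) X)).
have kE x : nat_of_ord (inord (index (c x) X) : 'I_(size X).-1.+1) = index (c x) X.
  by rewrite inordK // prednK // index_mem.
split; [|split] => [x y eq_k|x y ->//|i].
  have ei : index (c x) X = index (c y) X by rewrite -kE eq_k kE.
  by rewrite -[LHS](nth_index (c x) (cX x)) ei nth_index.
have lti : (i < size X)%N by rewrite -[ltnRHS]prednK.
have := mem_nth (c x0) lti; rewrite in_fset_set // inE => -[x _ cE].
by exists x; apply/val_inj; rewrite /= kE cE index_uniq // fset_uniq.
Qed.

End FiniteSets.

Section ConeTypes.
Local Open Scope classical_set_scope.
Local Open Scope nat_scope.
Local Open Scope group_scope.
Variables (G : groupType) (S : set G) (K : nat).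
Hypothesis (finS : finite_set S) (genS : generating S).
Local Notation l := (word_length S).
Local Notation d := (word_dist S).
Hypothesis fellow : forall x y p q,
  d x y <= 1%N -> l p + d p x = l x -> l q + d q y = l y -> l p = l q ->
  d p q <= K.

(* [monoid.mulgA] restated so that rewriting with it keeps the multiplication
   of [G] in the form that [lia] recognises. *)
Let mulgA (x y z : G) : x * (y * z) = x * y * z := mulgA x y z.

(** Cannon's cone type of [g]. *)
Definition cone (g : G) : set G := [set w | l (g * w) = l g + l w].

(** Cannon's [M]-tail; being a subset of a ball, it takes finitely many values. *)
Definition tail M (g : G) : set G := [set h | l h <= M /\ l (g * h) < l g].

(* Some geodesic from [1] to [g * v] passes through [g * h]. *)
Definition beyond (g h v : G) := l (g * v) = l (g * h) + d h v.

(* [g] and [g * h] are at the same distance from [1] and lie on geodesics from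
   [1] to a common endpoint. *)
Definition mates (g : G) : set G :=
  [set h | l (g * h) = l g /\ exists2 w, cone g w & beyond g h w].

(** The fibre over a mate [h] is the cone of [g * h] translated by [h] ([beyondE]), and the fibre
    over 1 is [cone g] ([cone_type1]). *)
Definition cone_type (g : G) : set (G * G) :=
  [set hv | mates g hv.1 /\ beyond g hv.1 hv.2].

(** Cannon's argument, by induction on the length of [w], with [v] its prefix. If [g' * w] were too
    short, a geodesic to it would pass, one level below [g'], through some [g' * h] that is
    [K]-close to a predecessor of [g']. Then [h] lies in the common tail, so [g * h] gives a
    shortcut to [g * w] as well. *)
Lemma tail_cone g g' : tail K.+1 g = tail K.+1 g' -> cone g `<=` cone g'.
Proof.
move=> eq_tail w; move Dn: (l w) => n; elim: n w Dn => [|n IH] w lw; rewrite /cone /= => gw.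
  by rewrite (word_length_eq0 genS lw) !mulg1 word_length1 // addn0.
have [|v lv dvw] := @word_length_prefix _ _ genS w n; first by rewrite lw.
have gvw x : l (x * w) <= l (x * v) + 1 /\ l (x * v) <= l (x * w) + 1.
  have := word_length_le_dist genS (x * v) (x * w).
  have := word_length_le_dist genS (x * w) (x * v).
  by rewrite (word_distC genS (x * w)) word_dist_mull // dvw; lia.
have {IH} g'v : l (g' * v) = l g' + l v.
  by apply: IH => //; have := word_lengthM genS g v; have := gvw g; rewrite /cone /=; lia.
apply/eqP; rewrite eqn_leq word_lengthM //= leqNgt; apply/negP => short.
have [g'1|g'_gt0] := posnP (l g').
  by move: short; rewrite (word_length_eq0 genS g'1) word_length1 // mul1g; lia.
have [|p lp dpg'] := @word_length_prefix _ _ genS g' (l g').-1; first by lia.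
have le_g'w := gvw g'.
have [|u lu dug'] := @word_length_prefix _ _ genS (g' * w) (l g').-1; first by lia.
have pg'v : l p + d p (g' * v) = l (g' * v).
  have := word_dist_triangle genS g' p (g' * v); have := word_length_le_dist genS p (g' * v).
  by rewrite word_dist_mulr; lia.
have ug'w : l u + d u (g' * w) = l (g' * w) by lia.
have d1 : d (g' * v) (g' * w) <= 1%N by rewrite word_dist_mull; lia.
have := fellow d1 pg'v ug'w (etrans lp (esym lu)) => dpu.
pose h := g'^-1 * u.
have g'h : g' * h = u by rewrite mulVKg.
have : tail K.+1 g' h.
  rewrite /tail /= g'h lu -(word_dist_mulr S g') g'h; split; last by lia.
  by have := word_dist_triangle genS p g' u; rewrite (word_distC genS g' p); lia.
rewrite -eq_tail => -[_ gh].
have := word_length_le_dist genS (g * h) (g * w).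
by rewrite word_dist_mull -(word_dist_mull S g') g'h; lia.
Qed.

(** Two geodesics to the common endpoint [g * w] fellow-travel. *)
Lemma mates_ball g h : mates g h -> l h <= K.
Proof.
move=> [lgh [w gw ghw]]; rewrite -(word_dist_mulr S g).
apply: (@fellow (g * w) (g * w)) => //; first by rewrite word_distxx.
  by rewrite word_dist_mulr.
by rewrite word_dist_mull.
Qed.

Lemma beyondE g h v : beyond g h v <-> cone (g * h) (h^-1 * v).
Proof. by rewrite /beyond /cone /= -mulgA mulVKg. Qed.

(** Mates have length at most [K], so the tail of radius [K.+1] of [g * h] can be read off from the
    tail of radius [K + K.+1] of [g], and [tail_cone] applies to each mate. *)
Lemma cone_type_eq g g' :
  mates g = mates g' -> tail (K + K.+1) g = tail (K + K.+1) g' ->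
  cone_type g = cone_type g'.
Proof.
wlog suff sub : g g' / mates g = mates g' -> tail (K + K.+1) g = tail (K + K.+1) g' ->
    cone_type g `<=` cone_type g'.
  by move=> em et; apply/seteqP; split; apply: sub.
move=> em et [h v] [/= gh /beyondE ghv]; have g'h := gh; rewrite em in g'h.
split=> //=; apply/beyondE; apply: tail_cone ghv; have lh := mates_ball gh; apply/seteqP.
have half a b : mates a h -> mates b h -> tail (K + K.+1) a = tail (K + K.+1) b ->
    tail K.+1 (a * h) `<=` tail K.+1 (b * h).
  move=> [lah _] [lbh _] eab k [lk]; rewrite lah -mulgA => ahk.
  have : tail (K + K.+1) b (h * k).
    by rewrite -eab; split=> //; have := word_lengthM genS h k; lia.
  by move=> [_ bhk]; split; rewrite // lbh -mulgA.
by split; apply: half.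
Qed.

Lemma finite_cone_types : finite_set (range cone_type).
Proof.
pose code g := (mates g, tail (K + K.+1) g).
apply: (@finite_range_factor _ _ _ code); last by move=> g g' [/cone_type_eq]; apply.
apply: (@sub_finite_set _ _ ([set B | B `<=` [set h | l h <= K]] `*`
                             [set B | B `<=` [set h | l h <= K + K.+1]])).
  move=> _ [g _ <-]; split=> /=; first exact: mates_ball.
  by move=> h [].
by apply: finite_setX; apply: finite_set_subsets; exact: finite_ball.
Qed.

Lemma cone_type1 g v : cone_type g (1, v) <-> cone g v.
Proof.
rewrite /cone_type /beyond /cone /= word_dist1 mulg1; split=> [[]//|gv]; split=> //.
split; rewrite ?mulg1 //; exists 1; first by rewrite /cone /= mulg1 word_length1 ?addn0.
by rewrite /beyond word_distxx ?addn0.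
Qed.

(** A mate [g * s * h'] of the child has a predecessor [g * h] at the level of [g]. It is a mate of
    [g], and whatever lies beyond [g * s * h'] lies beyond [g * h], so the type of [g] determines
    the relevant lengths. *)
Lemma cone_type_child g g' s :
  cone_type g = cone_type g' -> l s = 1%N -> cone g s ->
  cone_type (g * s) = cone_type (g' * s).
Proof.
move=> et ls; wlog suff sub : g g' et / cone g s -> cone_type (g * s) `<=` cone_type (g' * s).
  move=> gs; apply/seteqP; split; apply: sub => //.
  by apply/cone_type1; rewrite -et; apply/cone_type1.
move=> gs; have g's : cone g' s by apply/cone_type1; rewrite -et; apply/cone_type1.
move=> [h' v'] []; rewrite /= /mates /beyond /cone /= -!mulgA => -[lgsh' [w' gsw' gsh'w']] gsh'v'.
rewrite -mulgA in gsw' gsh'w'; have {}gs : l (g * s) = l g + 1 by rewrite gs ls.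
have [|p lp dp] := @word_length_prefix _ _ genS (g * (s * h')) (l g); first by lia.
pose h := g^-1 * p; have ghE : g * h = p by rewrite mulVKg.
have lgh : l (g * h) = l g by rewrite ghE.
have dh : d h (s * h') = 1%N by rewrite -(word_dist_mull S g) ghE; lia.
have dist_sv v : l (g * (s * v)) = l (g * (s * h')) + d h' v ->
    d h (s * v) = 1 + d h' v /\ beyond g h (s * v).
  have := word_dist_triangle genS (s * h') h (s * v).
  have := word_length_le_dist genS (g * h) (g * (s * v)).
  by rewrite !word_dist_mull /beyond; lia.
have gsw : cone g (s * w').
  by have := word_lengthM genS s w'; have := word_lengthM genS g (s * w'); rewrite /cone /=; lia.
have [dsw ghsw] := dist_sv w' gsh'w'; have [dsv ghsv] := dist_sv v' gsh'v'.
have [|_ ghsh] := dist_sv h'; first by rewrite word_distxx ?addn0.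
have gh : mates g h by split=> //; exists (s * w').
have transfer v : beyond g h v -> mates g' h /\ beyond g' h v.
  move=> ghv; have : cone_type g (h, v) by [].
  by rewrite et => -[].
have [[lg'h _]] := transfer _ ghsh; have [_] := transfer _ ghsw; have [_] := transfer _ ghsv.
have : cone g' (s * w') by apply/cone_type1; rewrite -et; apply/cone_type1.
have lsw : l (s * w') = 1 + l w'.
  by have := word_lengthM genS s w'; have := word_lengthM genS g (s * w'); lia.
rewrite /cone /beyond /= dsw dsv dh lsw => g'1 g'2 g'3 g'4.
have {}g's : l (g' * s) = l g' + 1 by rewrite g's ls.
split; rewrite /= /mates /beyond /cone /= -!mulgA; last by lia.
by split; [lia|exists w'; rewrite /= /beyond /cone /= -?mulgA; lia].
Qed.

(** Any other parent [g * s * t^-1] of the child [g * s] is a mate of [g], and is thus recorded in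
    its type. *)
Lemma cone_type_parent g g' s t :
  cone_type g = cone_type g' -> l s = 1%N -> l t = 1%N -> cone g s ->
  l (g * s * t^-1) = l g -> l (g' * s * t^-1) = l g'.
Proof.
move=> et ls lt gs; rewrite -!mulgA => lgst.
have : cone_type g (s * t^-1, s); last by rewrite et => -[[]].
have st : beyond g (s * t^-1) s.
  by rewrite /beyond lgst gs ls (word_distC genS) word_dist_mulr word_lengthV // lt.
by split=> //; split=> //=; exists s.
Qed.

End ConeTypes.

(** * The transfer matrix of the spheres *)

Section GrowthTransfer.
Local Open Scope classical_set_scope.
Local Open Scope ring_scope.
Variables (R : realType) (G : groupType) (S : set G).
Hypothesis (finS : finite_set S) (genS : generating S).
Local Notation l := (word_length S).

Definition sphere n : {fset G} := fset_set [set g | l g = n].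

Lemma finite_sphere n : finite_set [set g | l g = n].
Proof. by apply: sub_finite_set (finite_ball genS finS n) => g /= ->. Qed.

Lemma mem_sphere n g : (g \in sphere n) = (l g == n).
Proof.
rewrite in_fset_set; last exact: finite_sphere.
by apply/idP/eqP; rewrite inE.
Qed.

Definition parents g : R :=
  \sum_(s <- sphere 1) ((l (g * s^-1)%g).+1 == l g)%:R.

Lemma parents_neq0 n g : l g = n.+1 -> parents g != 0.
Proof.
move=> lg; have [|p lp dp] := @word_length_prefix _ _ genS g n; first by rewrite lg.
have ls : l (p^-1 * g)%g = 1%N by rewrite -/(word_dist S p g) dp lg subSnn.
rewrite gt_eqF // /parents (big_rem (p^-1 * g)%g) ?mem_sphere ?ls //=.
rewrite invgM invgK mulVKg lp lg eqxx ltr_pwDl ?ltr01 //.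
by apply: sumr_ge0 => s _; exact: ler0n.
Qed.

Lemma sphere_shift n s (F : G -> R) : l s = 1%N ->
  \sum_(h <- sphere n.+1 | l (h * s^-1)%g == n) F h =
  \sum_(g <- sphere n | l (g * s)%g == n.+1) F (g * s)%g.
Proof.
move=> ls; rewrite -big_filter -[RHS]big_filter -(big_map (fun g => g * s)%g predT F).
apply: perm_big; apply: uniq_perm.
- exact/filter_uniq/fset_uniq.
- by rewrite map_inj_uniq ?filter_uniq ?fset_uniq //; exact: mulIg.
move=> h; apply/idP/mapP => [|[g + ->]]; rewrite !mem_filter !mem_sphere.
  by move=> /andP[hs lh]; exists (h * s^-1)%g; rewrite ?mulgVK // mem_filter mem_sphere mulgVK lh.
by rewrite mulgK andbC.
Qed.

(* Each element of the sphere of radius [n.+1] is reached from [parents]-many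
   elements of the sphere of radius [n]; weighting by the inverse of that number
   avoids choosing normal forms. *)
Lemma sphere_sum n (F : G -> R) :
  \sum_(h <- sphere n.+1) F h =
  \sum_(g <- sphere n) \sum_(s <- sphere 1 | l (g * s)%g == n.+1)
     F (g * s)%g / parents (g * s)%g.
Proof.
transitivity (\sum_(h <- sphere n.+1) \sum_(s <- sphere 1 | l (h * s^-1)%g == n) F h / parents h).
  apply: eq_big_seq => h; rewrite mem_sphere => /eqP lh.
  rewrite -big_distrr /= -[LHS]mulr1; congr (_ * _).
  rewrite big_mkcond /= -[LHS](mulfV (parents_neq0 lh)) /parents.
  rewrite mulr_suml; apply: eq_bigr => s _.
  by rewrite lh eqSS; case: eqP => _; rewrite ?mul1r ?mul0r.
under eq_bigr do rewrite big_mkcond /=.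
under [RHS]eq_bigr do rewrite big_mkcond /=.
rewrite exchange_big [RHS]exchange_big /=; apply: eq_big_seq => s; rewrite mem_sphere => /eqP ls.
by rewrite -!big_mkcond /=; rewrite sphere_shift.
Qed.

Lemma growth_transfer (K : nat) :
  (forall x y p q, (word_dist S x y <= 1)%N ->
    (l p + word_dist S p x = l x)%N -> (l q + word_dist S q y = l y)%N ->
    l p = l q -> (word_dist S p q <= K)%N) ->
  exists N (A : 'M[R]_N.+1) (x : nat -> 'rV[R]_N.+1),
    [/\ forall i j, 0 <= A i j, forall n i, 0 <= x n 0 i,
        forall n, x n.+1 = x n *m A, forall i, exists n, 0 < x n 0 i &
        forall n, growth_series R S n = \sum_i x n 0 i].
Proof.
move=> fellow; pose type := cone_type S.
have [N [kappa [kappaP [kappa_eq kappa_surj]]]] :=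
  finite_range_index 1%g (finite_cone_types finS genS fellow).
have [rep repP] := boolp.choice kappa_surj.
pose x n : 'rV[R]_N.+1 := \row_i \sum_(g <- sphere n) (kappa g == i)%:R.
(* The entries are computed at a representative of each type; [cone_type_child] and
   [cone_type_parent] show that any other element of the type gives the same sum. *)
pose A : 'M[R]_N.+1 := \matrix_(i, j) \sum_(s <- sphere 1 | l (rep i * s)%g == (l (rep i)).+1)
  ((kappa (rep i * s)%g == j)%:R / parents (rep i * s)%g).
have xP n (F : 'I_N.+1 -> R) : \sum_i x n 0 i * F i = \sum_(g <- sphere n) F (kappa g).
  under eq_bigr do rewrite mxE mulr_suml.
  rewrite exchange_big; apply: eq_bigr => g _.
  rewrite (bigD1 (kappa g)) //= eqxx mul1r big1 ?addr0 // => i.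
  by rewrite eq_sym => /negbTE ->; rewrite mul0r.
have parents_ge0 g : 0 <= parents g by apply: sumr_ge0.
exists N, A, x; split.
- by move=> i j; rewrite mxE; apply: sumr_ge0 => s _; rewrite divr_ge0.
- by move=> n i; rewrite mxE; apply: sumr_ge0.
- move=> n; apply/rowP => j; rewrite !mxE sphere_sum xP.
  apply: eq_big_seq => g; rewrite mem_sphere => /eqP lg; rewrite mxE.
  have typeE : type (rep (kappa g)) = type g by apply: kappaP; rewrite repP.
  have coneE s : l s = 1%N ->
      (l (rep (kappa g) * s)%g == (l (rep (kappa g))).+1) = (l (g * s)%g == n.+1).
    move=> ls; apply/eqP/eqP => [rs|gs].
      have : cone S g s; last by rewrite /cone /= lg ls addn1.
      apply/cone_type1 => //; rewrite -/type -typeE; apply/cone_type1 => //.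
      by rewrite /cone /= rs ls addn1.
    have : cone S (rep (kappa g)) s; last by rewrite /cone /= ls addn1.
    apply/cone_type1 => //; rewrite -/type typeE; apply/cone_type1 => //.
    by rewrite /cone /= gs lg ls addn1.
  rewrite big_seq_cond [RHS]big_seq_cond; apply: eq_big => s.
    by rewrite mem_sphere; case: eqP => //= /coneE ->.
  rewrite mem_sphere => /andP[/eqP ls /eqP gs].
  have /eqP rs : l (rep (kappa g) * s)%g == (l (rep (kappa g))).+1 by rewrite coneE ?gs.
  have gs' : cone S g s by rewrite /cone /= gs lg ls addn1.
  have rs' : cone S (rep (kappa g)) s by rewrite /cone /= rs ls addn1.
  congr ((_ == j)%:R / _).
    by apply: kappa_eq; apply/esym; apply: (cone_type_child genS).
  apply: eq_big_seq => t; rewrite mem_sphere => /eqP lt; rewrite gs rs !eqSS -lg.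
  congr (_%:R); apply: congr1; apply/eqP/eqP.
    exact: (cone_type_parent genS).
  exact: (cone_type_parent genS).
- move=> i; exists (l (rep i)); rewrite mxE (big_rem (rep i)) ?mem_sphere //=.
  by rewrite repP eqxx ltr_pwDl ?ltr01 // sumr_ge0.
- move=> n; have := xP n (fun=> 1); under eq_bigr do rewrite mulr1.
  by move=> ->; rewrite big_const_seq count_predT iter_addr_0 /growth_series /sphere_card.
Qed.

End GrowthTransfer.

(** * Peripheral eigenvalues of nonnegative matrices *)

Section ExponentialBounds.
Local Open Scope ring_scope.
Variable F : numFieldType.

Definition exp_bounded (theta : F) (c : nat -> F) :=
  exists2 K, 0 <= K & forall n, `|c n| <= K * theta ^+ n.

(** The operator [E - nu], with [E] the shift of sequences; products of such operators are written
    as a [foldr]. *)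
Definition shift_sub (nu : F) (c : nat -> F) n := c n.+1 - nu * c n.

Lemma exp_bounded_shift_sub theta nu c :
  `|nu| < theta -> exp_bounded theta (shift_sub nu c) -> exp_bounded theta c.
Proof.
move=> lt_nu [K K0 cK]; have gap : 0 < theta - `|nu| by rewrite subr_gt0.
have theta0 : 0 < theta by apply: le_lt_trans lt_nu.
have K'0 : 0 <= K / (theta - `|nu|) by rewrite divr_ge0 // ltW.
exists (`|c 0| + K / (theta - `|nu|)); first by rewrite addr_ge0.
elim=> [|n IH]; first by rewrite expr0 mulr1 lerDl.
have -> : c n.+1 = shift_sub nu c n + nu * c n by rewrite subrK.
apply: le_trans (ler_normD _ _) _; rewrite normrM.
apply: le_trans (lerD (cK n) (ler_wpM2l (normr_ge0 nu) IH)) _.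
(* The constant [X] is chosen so that this inequality closes the induction. *)
set X := `|c 0| + _; have le_X : K + `|nu| * X <= theta * X.
  rewrite -lerBrDr -mulrBl /X mulrDr mulrCA mulfV ?gt_eqF // mulr1 lerDr.
  by rewrite mulr_ge0 // ltW.
rewrite mulrA -mulrDl exprS mulrCA mulrA ler_wpM2r ?exprn_ge0 ?(ltW theta0) //.
Qed.

Lemma exp_bounded_foldr theta rs c :
  all (fun nu => `|nu| < theta) rs -> exp_bounded theta (foldr shift_sub c rs) ->
  exp_bounded theta c.
Proof.
elim: rs => //= nu rs IH /andP[lt_nu lt_rs] /exp_bounded_shift_sub => /(_ lt_nu).
exact: IH.
Qed.

(** On entries of [M * A ^+ n * Q] the shift acts as multiplication by [A]; Cayley-Hamilton thereby
    becomes a linear recurrence. *)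
Lemma foldr_shift_sub_mx N (A M Q : 'M[F]_N.+1) rs i j n :
  foldr shift_sub (fun n => (M * A ^+ n * Q) i j) rs n =
  (M * A ^+ n * (\prod_(nu <- rs) (A - nu%:M)) * Q) i j.
Proof.
elim: rs n => [|nu rs IH] n /=; first by rewrite big_nil mulr1.
rewrite /shift_sub !IH big_cons exprSr.
have -> : forall (B C : 'M[F]_N.+1) x, B i j - x * C i j = (B - x *: C) i j.
  by move=> B C x; rewrite !mxE.
congr (fun_of_matrix _ i j).
rewrite mulrBl mulrBr (_ : nu%:M * _ = nu *: \prod_(j <- rs) (A - j%:M)).
  by rewrite -scalerAr !mulrA mulrBl -scalerAl.
exact: mul_scalar_mx.
Qed.

End ExponentialBounds.

Section NonnegativeMatrix.
Local Open Scope ring_scope.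

Lemma exp_unbounded (R : realType) (rho theta K x : R[i]) :
  0 < theta -> theta < rho -> 0 < x -> (forall n, rho ^+ n * x <= K * theta ^+ n) -> False.
Proof.
move=> theta0 lt_tr x0 bound; pose q := rho / theta - 1.
have q0 : 0 < q by rewrite subr_gt0 ltr_pdivlMr ?mul1r.
have bernoulli n : 1 + n%:R * q <= (1 + q) ^+ n.
  elim: n => [|n IH]; first by rewrite mul0r addr0.
  rewrite exprS mulrDl mul1r mulrSr mulrDl mul1r addrA lerD //.
  by rewrite ler_peMr ?(ltW q0) // exprn_ege1 // lerDl ltW.
have linear n : n%:R * q <= K / x.
  apply: le_trans (_ : (1 + q) ^+ n <= _); first by apply: le_trans (bernoulli n); rewrite lerDr.
  rewrite /q addrC subrK expr_div_n ler_pdivlMr // mulrAC ler_pdivrMr ?exprn_gt0 //.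
(* The Archimedean argument is carried out on real parts, in [R]. *)
have Re_gt0 : 0 < complex.Re q by move: q0; rewrite ltcE => /andP[].
pose n := Num.bound `|complex.Re (K / x) / complex.Re q|.
have : n%:R * complex.Re q <= complex.Re (K / x).
  have ReM m : complex.Re (m%:R * q) = m%:R * complex.Re q.
    rewrite !mulr_natl; elim: m => // m IH; rewrite !mulrS -IH.
    by case: (q) (q *+ m) => [a b] [c d].
  by have := linear n; rewrite lecE ReM => /andP[].
rewrite leNgt => /negP[]; rewrite -ltr_pdivrMr //.
exact: le_lt_trans (ler_norm _) (archi_boundP (normr_ge0 _)).
Qed.

Lemma mx_power_ge0 (F : numDomainType) N (A : 'M[F]_N.+1) n i j :
  (forall i j, 0 <= A i j) -> 0 <= (A ^+ n) i j.
Proof.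
move=> A_ge0; elim: n i j => [|n IH] i j; first by rewrite expr0 mxE ler0n.
by rewrite exprS mxE sumr_ge0 // => k _; rewrite mulr_ge0.
Qed.

End NonnegativeMatrix.

Section Perron.
Local Open Scope ring_scope.
Variable R : realType.
Local Notation C := R[i].
Variables (N : nat) (A : 'M[C]_N.+1) (rs : seq C).
Hypothesis char_polyE : char_poly A = \prod_(nu <- rs) ('X - nu%:P).

Lemma prod_sub_eigenvalues_eq0 : \prod_(nu <- rs) (A - nu%:M) = 0.
Proof.
rewrite -(Cayley_Hamilton A) char_polyE rmorph_prod; apply: eq_bigr => nu _.
by rewrite rmorphB /= horner_mx_X horner_mx_C.
Qed.

Lemma exp_bounded_power theta (M Q : 'M[C]_N.+1) i j :
  all (fun nu => `|nu| < theta) rs -> exp_bounded theta (fun n => (M * A ^+ n * Q) i j).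
Proof.
move=> lt_rs; apply: (exp_bounded_foldr lt_rs); exists 0 => // n.
by rewrite foldr_shift_sub_mx prod_sub_eigenvalues_eq0 mulr0 mul0r mxE normr0 mul0r.
Qed.

Hypothesis A_ge0 : forall i j, 0 <= A i j.

Lemma row_power_ge0 (y : 'rV[C]_N.+1) n j : (forall i, 0 <= y 0 i) -> 0 <= (y *m A ^+ n) 0 j.
Proof. by move=> y0; rewrite mxE sumr_ge0 // => i _; rewrite mulr_ge0 // mx_power_ge0. Qed.

Lemma row_power_gt0 (y : 'rV[C]_N.+1) n i j :
  (forall i, 0 <= y 0 i) -> y 0 i != 0 -> (A ^+ n) i j != 0 -> 0 < (y *m A ^+ n) 0 j.
Proof.
move=> y0 yi Aij; rewrite mxE (bigD1 i) //= ltr_pwDl //; last first.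
  by apply: sumr_ge0 => k _; rewrite mulr_ge0 // mx_power_ge0.
by rewrite mulr_gt0 ?lt0r ?yi ?y0 ?Aij ?mx_power_ge0.
Qed.

Lemma row_power_neq0 (y : 'rV[C]_N.+1) n j :
  (y *m A ^+ n) 0 j != 0 -> exists i, y 0 i != 0 /\ (A ^+ n) i j != 0.
Proof.
move=> yA; have /existsP[i /andP[yi Aij]] : [exists i, (y 0 i != 0) && ((A ^+ n) i j != 0)].
  apply: contraR yA => /existsPn none; rewrite mxE big1 // => i _.
  by move: (none i); rewrite negb_and !negbK => /orP[] /eqP ->; rewrite ?mul0r ?mulr0.
by exists i.
Qed.

Definition edge : rel 'I_N.+1 := fun i j => A i j != 0.

Lemma power_connect n i j : (A ^+ n) i j != 0 -> connect edge i j.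
Proof.
elim: n i => [|n IH] i.
  by rewrite expr0 mxE; have [->|] := eqVneq i j; rewrite ?connect0 ?eqxx.
rewrite exprS => Aij.
have /row_power_neq0[k [ik /IH kj]] : (row i A *m A ^+ n) 0 j != 0 by rewrite -row_mul mxE.
by apply: connect_trans kj; apply: connect1; move: ik; rewrite mxE.
Qed.

(** A path without repetition has fewer than [N.+1] edges, so a sum over [k < N.+1] of powers of [A]
    detects every connection. *)
Lemma connect_power i j : connect edge i j -> exists2 n, (n < N.+1)%N & (A ^+ n) i j != 0.
Proof.
move=> /connectP[p pathp ->]; case/shortenP: pathp => q pathq uniqq _ {p}.
exists (size q).
  have := uniq_leq_size uniqq (fun x _ => mem_enum _ x : x \in enum 'I_N.+1).
  by rewrite size_enum_ord.
elim: q i pathq {uniqq} => [|k q IH] i /=; first by rewrite expr0 mxE eqxx oner_neq0.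
move=> /andP[ik /IH Akj]; rewrite exprS.
have := @row_power_gt0 (row i A) (size q) k (last k q).
by rewrite -row_mul !mxE => pos; rewrite gt_eqF ?pos // => l; rewrite mxE.
Qed.

(* A nonnegative row vector on whose support [A] expands strictly by more than
   [r] would grow faster than the eigenvalues allow. *)
Lemma no_strict_expansion (r : C) (y : 'rV[C]_N.+1) j0 :
  0 < r -> all (fun nu => `|nu| <= r) rs -> (forall j, 0 <= y 0 j) -> y 0 j0 != 0 ->
  (forall j, y 0 j != 0 -> r * y 0 j < (y *m A) 0 j) -> False.
Proof.
move=> r0 le_rs y0 yj0 expand.
have gap j : y 0 j != 0 -> 0 < (y *m A) 0 j - r * y 0 j by move=> /expand; rewrite subr_gt0.
have pos j : y 0 j != 0 -> 0 < y 0 j by move=> yj; rewrite lt0r yj y0.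
(* Since [s] dominates all these ratios, [r + s^-1] is an expansion factor valid at every index. *)
pose s := \sum_(j | y 0 j != 0) y 0 j / ((y *m A) 0 j - r * y 0 j).
have s_ge j : y 0 j != 0 -> y 0 j / ((y *m A) 0 j - r * y 0 j) <= s.
  move=> yj; rewrite /s (bigD1 j) //= lerDl sumr_ge0 // => k /andP[yk _].
  by rewrite divr_ge0 // ltW // gap.
have s0 : 0 < s by apply: lt_le_trans (s_ge j0 yj0); rewrite divr_gt0 ?gap ?pos.
have step j : (r + s^-1) * y 0 j <= (y *m A) 0 j.
  have [->|yj] := eqVneq (y 0 j) 0.
    by rewrite mulr0 mxE sumr_ge0 // => k _; rewrite mulr_ge0.
  rewrite mulrDl -lerBrDl mulrC ler_pdivrMr // mulrC -ler_pdivrMr ?gap //.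
  exact: s_ge.
have grow n j : (r + s^-1) ^+ n * y 0 j <= (y *m A ^+ n) 0 j.
  elim: n j => [|n IH] j; first by rewrite !expr0 mul1r mulmx1.
  rewrite exprS mulrAC; apply: le_trans (ler_wpM2r _ (step j)) _.
    by rewrite exprn_ge0 // ltW // addr_gt0 ?invr_gt0.
  rewrite (_ : A ^+ n.+1 = A ^+ n *m A) ?exprSr // mulmxA !mxE mulr_suml ler_sum // => i _.
  by rewrite mulrAC ler_wpM2r // mulrC.
pose theta := r + s^-1 / 2.
have lt_rs : all (fun nu => `|nu| < theta) rs.
  apply/allP => nu /(allP le_rs) => /le_lt_trans; apply.
  by rewrite ltrDl divr_gt0 ?invr_gt0.
(* The bound is stated for square matrices, so [y] is repeated in every row. *)
have [K K0 boundK] := exp_bounded_power (\matrix_(i, k) y 0 k) 1 0 j0 lt_rs.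
apply: (@exp_unbounded _ (r + s^-1) theta K (y 0 j0)); rewrite ?pos //.
- by rewrite addr_gt0 // divr_gt0 ?invr_gt0.
- by rewrite ltrD2l ltr_pdivrMr // mulr_natr mulr2n ltrDl invr_gt0.
move=> n; apply: le_trans (grow n j0) _; apply: le_trans (boundK n).
have -> : (\matrix_(i, k) y 0 k * A ^+ n * 1) 0 j0 = (y *m A ^+ n) 0 j0.
  by rewrite mulr1 !mxE; apply: eq_bigr => i _; rewrite mxE.
by rewrite ger0_norm // row_power_ge0.
Qed.

(* For an eigenvector [v] of [mu], the inequality [r |v| <= |v| A] must be an
   equality somewhere on the support of [v], by the previous lemma; where it
   holds, all [v_i] with [A i j != 0] have the same phase, namely [mu / r] times
   that of [v_j]. Following such predecessors until an index recurs shows that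
   [mu / r] is a root of unity. *)
Lemma peripheral_eigenvalue mu :
  mu \in rs -> mu != 0 -> all (fun nu => `|nu| <= `|mu|) rs ->
  exists2 p, (0 < p <= N.+1)%N & mu ^+ p = `|mu| ^+ p.
Proof.
move=> mu_rs mu0 le_rs; set r := `|mu|; have r0 : 0 < r by rewrite normr_gt0.
have : eigenvalue A mu by rewrite eigenvalue_root_char char_polyE root_prod_XsubC.
case/eigenvalueP => v vA v0.
pose z : 'rV[C]_N.+1 := \row_j `|v 0 j|.
have z0 j : 0 <= z 0 j by rewrite mxE.
have zAE j : (z *m A) 0 j = \sum_i `|v 0 i * A i j|.
  by rewrite mxE; apply: eq_bigr => i _; rewrite mxE normrM (ger0_norm (A_ge0 _ _)).
have vAE j : \sum_i v 0 i * A i j = mu * v 0 j by have /rowP/(_ j) := vA; rewrite !mxE.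
pose e : 'rV[C]_N.+1 := z *m A - r *: z.
have eE j : e 0 j = (z *m A) 0 j - r * z 0 j by rewrite !mxE.
have e0 j : 0 <= e 0 j.
  by rewrite eE subr_ge0 zAE mxE -normrM -vAE ler_norm_sum.
(* Bad indices are reachable from a place where [r |v| <= |v| A] is strict. If the whole support
   were bad, the sum [y] of the rescaled iterates of [z] would expand strictly on its support,
   against [no_strict_expansion]. *)
pose bad j := [exists i, (e 0 i != 0) && connect edge i j].
have [/existsP[j0 /andP[zj0 goodj0]]|/existsPn allbad] :=
  boolP [exists j, (z 0 j != 0) && ~~ bad j]; last first.
  pose y : 'rV[C]_N.+1 := \sum_(k < N.+1) r ^- k *: (z *m A ^+ k).
  have rk0 k : 0 < r ^- k by rewrite invr_gt0 exprn_gt0.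
  have yE j : y 0 j = \sum_(k < N.+1) r ^- k * (z *m A ^+ k) 0 j.
    by rewrite summxE; apply: eq_bigr => k _; rewrite mxE.
  have y0 j : 0 <= y 0 j.
    by rewrite yE sumr_ge0 // => k _; rewrite mulr_ge0 ?(ltW (rk0 _)) ?row_power_ge0.
  have yAE j : (y *m A) 0 j - r * y 0 j = \sum_(k < N.+1) r ^- k * (e *m A ^+ k) 0 j.
    have -> : (y *m A) 0 j - r * y 0 j = (y *m A - r *: y) 0 j by rewrite !mxE.
    rewrite mulmx_suml scaler_sumr -sumrB summxE; apply: eq_bigr => k _.
    rewrite -scalemxAl scalerA mulrC -scalerA -scalerBr mxE; congr (_ * fun_of_matrix _ 0 j).
    by rewrite mulmxBl -scalemxAl -!mulmxA !mulmxE -exprS -exprSr.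
  have [j1 zj1] : exists j, z 0 j != 0.
    by have /rV0Pn[j vj] := v0; exists j; rewrite mxE normr_eq0.
  apply: False_ind; apply: (@no_strict_expansion r y j1) => //.
    rewrite yE gt_eqF // (bigD1 ord0) //= ltr_pwDl //; last first.
      by apply: sumr_ge0 => k _; rewrite mulr_ge0 ?(ltW (rk0 _)) ?row_power_ge0.
    by rewrite expr0 invr1 mul1r expr0 mulmx1 lt0r zj1 z0.
  move=> j yj; rewrite -subr_gt0 yAE.
  have [k /row_power_neq0[i [zi Aij]]] : exists k : 'I_N.+1, (z *m A ^+ k) 0 j != 0.
    have /existsP : [exists k : 'I_N.+1, (z *m A ^+ k) 0 j != 0] by
      apply: contraR yj => /existsPn none; rewrite yE big1 // => k _;
      by move: (none k); rewrite negbK => /eqP ->; rewrite mulr0.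
    by case=> k; exists k.
  move: (allbad i); rewrite zi negbK => /existsP[i0 /andP[ei0 i0i]].
  have [k' lt_k' Ai0j] := connect_power (connect_trans i0i (power_connect Aij)).
  rewrite (bigD1 (Ordinal lt_k')) //= ltr_pwDl //; last first.
    by apply: sumr_ge0 => k'' _; rewrite mulr_ge0 ?(ltW (rk0 _)) ?row_power_ge0.
  by rewrite mulr_gt0 // (row_power_gt0 e0 ei0).
pose good j := (z 0 j != 0) && ~~ bad j.
(* The quotient [v 0 j / z 0 j] is the phase of [v 0 j]. At a good [j] the triangle inequality is an
   equality, so the nonzero [v 0 i * A i j] share a phase [t]; a predecessor of an index that is not
   bad is not bad either. *)
have pred_good j : good j -> exists i, good i /\ mu / r * (v 0 j / z 0 j) = v 0 i / z 0 i.
  move=> /andP[zj goodj]; have ej : e 0 j = 0.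
    apply: contraNeq goodj => ej; apply/existsP; exists j; rewrite ej; exact: connect0.
  have tight : `|\sum_i v 0 i * A i j| = \sum_i `|v 0 i * A i j|.
    by rewrite -zAE vAE normrM; move/eqP: ej; rewrite eE subr_eq0 => /eqP ->; rewrite mxE.
  have [t _ tP] := normC_sum_eq tight.
  have [i ij] : exists i, v 0 i * A i j != 0.
    apply/existsP; apply: contraR zj => /existsPn none.
    have : mu * v 0 j == 0 by rewrite -vAE big1 // => i _; apply/eqP; rewrite -[_ == _]negbK none.
    by rewrite mulf_eq0 (negbTE mu0) mxE normr_eq0.
  move: (ij); rewrite mulf_eq0 negb_or => /andP[vi Aij].
  have zi : z 0 i != 0 by rewrite mxE normr_eq0.
  exists i; split.
    rewrite /good zi; apply: contra goodj => /existsP[i0 /andP[ei0 i0i]].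
    by apply/existsP; exists i0; rewrite ei0 (connect_trans i0i) ?connect1.
  have -> : v 0 i / z 0 i = t.
    apply: (mulfI zi); rewrite mulrCA mulfV // mulr1.
    apply: (mulIf Aij); rewrite tP // normrM (ger0_norm (A_ge0 _ _)) mxE.
    by rewrite mulrAC.
  have muvj : mu * v 0 j = r * z 0 j * t.
    rewrite -vAE (eq_bigr _ tP) -mulr_suml -zAE; congr (_ * t).
    by apply/eqP; rewrite -subr_eq0 -eE ej.
  rewrite mulrACA muvj -invfM mulrAC mulfV ?mul1r //.
  by rewrite mulf_neq0 // gt_eqF.
pose f j := odflt j [pick i | good i && (mu / r * (v 0 j / z 0 j) == v 0 i / z 0 i)].
have fP j : good j -> good (f j) /\ v 0 (f j) / z 0 (f j) = mu / r * (v 0 j / z 0 j).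
  move=> gj; rewrite /f; case: pickP => [i /andP[gi /eqP]//|none].
  by have [i [gi ei]] := pred_good j gj; move: (none i); rewrite gi ei eqxx.
have iterP n : good (iter n f j0) /\
    v 0 (iter n f j0) / z 0 (iter n f j0) = (mu / r) ^+ n * (v 0 j0 / z 0 j0).
  elim: n => [|n [gn en]] /=; first by rewrite expr0 mul1r; split=> //; rewrite /good zj0.
  by have [-> ->] := fP _ gn; rewrite en exprS mulrA.
have := looping_order f j0; rewrite /looping => /trajectP[k lt_k loop].
have le_order : (fingraph.order f j0 <= N.+1)%N by rewrite -[leqRHS]card_ord max_card.
exists (fingraph.order f j0 - k)%N; first by rewrite subn_gt0 lt_k (leq_trans (leq_subr _ _)).
have [_ ek] := iterP k; have [_ en] := iterP (fingraph.order f j0).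
have u0 : v 0 j0 / z 0 j0 != 0.
  by rewrite mulf_neq0 ?invr_eq0 //; move: zj0; rewrite mxE normr_eq0.
move: en; rewrite loop ek => /(mulIf u0).
rewrite -[in X in _ = X -> _](subnKC (ltnW lt_k)) exprD.
rewrite -[in X in X = _ -> _](mulr1 (_ ^+ k)) => /mulfI.
have qk0 : (mu / r) ^+ k != 0 by rewrite expf_neq0 // mulf_neq0 // invr_eq0 gt_eqF.
move=> /(_ qk0)/esym.
by rewrite expr_div_n => /divr1_eq ->.
Qed.

End Perron.

(** * Sequences with binomial asymptotics *)

Section BinomialAsymptotics.
Local Open Scope classical_set_scope.
Local Open Scope ring_scope.
Variable R : realType.
Implicit Types (c : nat -> R) (alpha : R) (d m : nat).

(** Binomials replace powers of [m] because, by Pascal's rule, ['C(m, d.+1)] is an exact primitive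
    of ['C(m, d)]. *)
Definition asymp_bin d alpha c := forall eps, 0 < eps -> exists M, forall m,
  (M <= m)%N -> `|c m - alpha * 'C(m, d)%:R| <= eps * 'C(m, d)%:R.

Lemma nat_unbounded (B : R) : exists M, forall m, (M <= m)%N -> B <= m%:R.
Proof.
exists (Num.bound `|B|) => m leM; apply: le_trans (ler_norm _) _.
apply: le_trans (ltW (archi_boundP (normr_ge0 _))) _.
by rewrite ler_nat.
Qed.

Lemma leq_bin_sub m d : (m - d <= 'C(m, d.+1))%N.
Proof.
elim: m => // m IH; rewrite binS; case: (leqP d m) => [|lt_md]; last by lia.
by rewrite -bin_gt0; lia.
Qed.

Lemma leq_bin2 m j k : (j <= k)%N -> (2 * k <= m)%N -> ('C(m, j) <= 'C(m, k))%N.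
Proof.
elim: k => [|k IH]; first by rewrite leqn0 => /eqP ->.
rewrite leq_eqVlt => /predU1P[-> //|]; rewrite ltnS => le_jk le_km.
apply: leq_trans (IH le_jk _) _; first by lia.
have := mul_bin_left m k; nia.
Qed.

Lemma bin_unbounded d (B : R) : exists M, forall m, (M <= m)%N -> B <= 'C(m, d.+1)%:R.
Proof.
have [M MP] := nat_unbounded B; exists (M + d)%N => m le_m.
apply: le_trans (MP (m - d)%N _) _; first by lia.
by rewrite ler_nat leq_bin_sub.
Qed.

Lemma exp_le_eventually (K eta eps : R) : 0 <= eta < 1 -> 0 < eps ->
  exists M, forall m, (M <= m)%N -> K * eta ^+ m <= eps.
Proof.
move=> /andP[eta0 eta1] eps0.
have eta_cvg : (fun n => eta ^+ n) @ \oo --> (0 : R) by apply: cvg_expr; rewrite ger0_norm.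
have : (fun n => K * eta ^+ n) @ \oo --> (0 : R).
  by rewrite -(mulr0 K); apply: cvgM => //; exact: cvg_cst.
move=> /cvgrPdist_le/(_ _ eps0)[M _ MP].
exists M => m le_m; have := MP m le_m; rewrite /= sub0r normrN.
exact: le_trans (ler_norm _).
Qed.

(** With [K' = K / (1 - theta)], the sequence [c m - K' * theta ^+ m] increases and
    [c m + K' * theta ^+ m] decreases; [L] is the supremum of the former. *)
Lemma exp_bounded_primitive (theta : R) c : 0 <= theta < 1 ->
  exp_bounded theta (shift_sub 1 c) -> exists L, exp_bounded theta (fun m => c m - L).
Proof.
move=> /andP[theta0 theta1] [K K0 cK]; pose K' := K / (1 - theta).
have gap : 0 < 1 - theta by rewrite subr_gt0.
have K'E : K + K' * theta = K' by rewrite /K'; field; rewrite gt_eqF.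
have K'0 : 0 <= K' by rewrite divr_ge0 // ltW.
have step m : `|c m.+1 - c m| <= K' * theta ^+ m - K' * theta ^+ m.+1.
  have -> : K' * theta ^+ m - K' * theta ^+ m.+1 = K * theta ^+ m.
    by rewrite exprS -{1}K'E; ring.
  by have := cK m; rewrite /shift_sub mul1r.
have lower m n : (m <= n)%N -> c m - K' * theta ^+ m <= c n - K' * theta ^+ n.
  move=> /subnKC <-; elim: (n - m)%N => [|k IH]; first by rewrite addn0.
  apply: le_trans IH _; rewrite addnS; have := step (m + k)%N.
  by rewrite ler_norml => /andP[+ _]; lra.
have upper m n : (m <= n)%N -> c n + K' * theta ^+ n <= c m + K' * theta ^+ m.
  move=> /subnKC <-; elim: (n - m)%N => [|k IH]; first by rewrite addn0.
  apply: le_trans IH; rewrite addnS; have := step (m + k)%N.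
  by rewrite ler_norml => /andP[_ +]; lra.
have cross m n : c m - K' * theta ^+ m <= c n + K' * theta ^+ n.
  apply: le_trans (lower _ _ (leq_maxl m n)) _; apply: le_trans (upper _ _ (leq_maxr m n)).
  have : 0 <= K' * theta ^+ maxn m n by rewrite mulr_ge0 ?exprn_ge0.
  lra.
pose E := [set c m - K' * theta ^+ m | m in setT].
have ubE n : ubound E (c n + K' * theta ^+ n) by move=> _ [m _ <-].
have E0 : E !=set0 by exists (c 0 - K' * theta ^+ 0), 0%N.
exists (sup E), K' => // m; rewrite ler_norml; apply/andP; split.
  have := ge_sup E0 (ubE m); lra.
have : c m - K' * theta ^+ m <= sup E.
  by apply: ub_le_sup; [exists (c 0 + K' * theta ^+ 0)|exists m].
lra.
Qed.

(** The estimate is summed from [M1] on with [eps / 2]; the other half absorbs the initial value, as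
    ['C(m, d.+1)] is unbounded. *)
Lemma asymp_bin_primitive d alpha c :
  asymp_bin d alpha (shift_sub 1 c) -> asymp_bin d.+1 alpha c.
Proof.
move=> asy eps eps0; have eps20 : 0 < eps / 2 by rewrite divr_gt0.
have [M1 M1P] := asy _ eps20.
have sumP m : (M1 <= m)%N ->
    `|c m - c M1 - alpha * ('C(m, d.+1)%:R - 'C(M1, d.+1)%:R)| <=
    eps / 2 * ('C(m, d.+1)%:R - 'C(M1, d.+1)%:R).
  move=> /subnKC <-; elim: (m - M1)%N => [|k IH].
    by rewrite addn0 !subrr !mulr0 subr0 normr0.
  rewrite addnS binS natrD; have := M1P (M1 + k)%N (leq_addr _ _).
  rewrite /shift_sub mul1r; move: IH; rewrite !ler_norml => /andP[+ +] /andP[].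
  by nra.
have [M2 M2P] := bin_unbounded d ((`|c M1| + `|alpha| * 'C(M1, d.+1)%:R) / (eps / 2)).
exists (maxn M1 M2) => m; rewrite geq_max => /andP[/sumP le1 /M2P].
rewrite ler_pdivrMr // => le2.
have B0 : 0 <= 'C(M1, d.+1)%:R :> R by [].
have -> : c m - alpha * 'C(m, d.+1)%:R = (c m - c M1 - alpha * ('C(m, d.+1)%:R - 'C(M1, d.+1)%:R))
    + (c M1 - alpha * 'C(M1, d.+1)%:R) by ring.
apply: le_trans (ler_normD _ _) _; have := ler_normB (c M1) (alpha * 'C(M1, d.+1)%:R).
rewrite normrM (ger0_norm B0); nra.
Qed.

(** The differences are undone one by one. A primitive of a decaying sequence decays up to a
    constant; a nonzero constant starts the second case with [d = 0], and each later primitive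
    raises [d] by one. *)
Lemma asymp_bin_dichotomy D (eta : R) c : 0 <= eta < 1 ->
  exp_bounded eta (foldr (@shift_sub R) c (nseq D 1)) ->
  exp_bounded eta c \/ exists d alpha, alpha != 0 /\ asymp_bin d alpha c.
Proof.
move=> eta01 bound.
have : exp_bounded eta (foldr (@shift_sub R) c (nseq D 1)) \/ exists d alpha,
  alpha != 0 /\ asymp_bin d alpha (foldr (@shift_sub R) c (nseq D 1)) by left.
elim: D {bound} => [|D IH] //= alt; apply: IH; move: alt; set b := foldr _ _ _.
case=> [/(exp_bounded_primitive eta01)[L bL]|[d [alpha [alpha0 asy]]]]; last first.
  by right; exists d.+1, alpha; split=> //; exact: asymp_bin_primitive.
have [L0|L0] := eqVneq L 0; [left|right].
  by case: bL => K K0 bK; exists K => // n; have := bK n; rewrite L0 subr0.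
exists 0, L; split=> // eps eps0; case: bL => K K0 bK.
have [M MP] := exp_le_eventually K eta01 eps0; exists M => m /MP le_eps.
by rewrite bin0 !mulr1; exact: le_trans (bK m) le_eps.
Qed.

Lemma asymp_bin_gt0 d alpha c :
  (forall m, 0 <= c m) -> alpha != 0 -> asymp_bin d alpha c -> 0 < alpha.
Proof.
move=> c0 alpha0 asy; rewrite lt_neqAle eq_sym alpha0 leNgt; apply/negP => neg.
have [|M MP] := asy (- alpha / 2); first by rewrite divr_gt0 // oppr_gt0.
have := MP (maxn M d) (leq_maxl _ _); have := c0 (maxn M d).
have : 0 < 'C(maxn M d, d)%:R :> R by rewrite ltr0n bin_gt0 leq_maxr.
by rewrite ler_norml => + + /andP[_]; nra.
Qed.

Lemma asymp_bin_cvg d alpha c :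
  asymp_bin d alpha c -> (fun m => c m / 'C(m, d)%:R) @ \oo --> alpha.
Proof.
move=> asy; apply/cvgrPdist_le => eps /asy[M MP].
exists (maxn M d) => // m; rewrite /= geq_max => /andP[/MP le_eps le_dm].
have C0 : 0 < 'C(m, d)%:R :> R by rewrite ltr0n bin_gt0.
by rewrite distrC -(ler_pM2r C0) -[X in _ * X](gtr0_norm C0) -normrM mulrBl divfK ?gt_eqF.
Qed.

Lemma asymp_bin_ratio d alpha beta b c :
  beta != 0 -> asymp_bin d alpha b -> asymp_bin d beta c ->
  (fun m => b m / c m) @ \oo --> alpha / beta.
Proof.
move=> beta0 /asymp_bin_cvg bP /asymp_bin_cvg cP.
have lim : (fun m => b m / 'C(m, d)%:R * (c m / 'C(m, d)%:R)^-1) @ \oo --> alpha / beta.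
  by apply: cvgM => //; apply: cvgV.
apply: cvg_trans lim; apply: near_eq_cvg.
exists d => // m /= le_dm; have C0 : 'C(m, d)%:R != 0 :> R by rewrite pnatr_eq0 -lt0n bin_gt0.
by rewrite /= invfM invrK mulrACA mulVf // mulr1.
Qed.

(* The shift [s] serves to compare a sequence with a translate of another. *)
Lemma asymp_bin_le d d' alpha alpha' b c s (K : R) :
  0 < alpha -> asymp_bin d alpha b -> asymp_bin d' alpha' c ->
  (forall m, b (m + s)%N <= K * c m) -> 0 <= K -> (d <= d')%N.
Proof.
move=> alpha0 asy asy' le_bc K0; rewrite leqNgt; apply/negP => lt_d.
have [|M MP] := asy (alpha / 2); first by rewrite divr_gt0.
have [M' MP'] := asy' 1 ltr01.
have [M2 M2P] := nat_unbounded ((K * (alpha' + 1) * d%:R + 1) / (alpha / 2)).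
(* The term [2 * d] keeps ['C(m, j)] nondecreasing for [j <= d]; [M2] makes ['C(m, d)] too large
   compared with ['C(m, d')]. *)
pose m := (M + M' + M2 + 2 * d)%N.
have bm : alpha / 2 * 'C(m, d)%:R <= b (m + s)%N.
  have := MP (m + s)%N ltac:(rewrite /m; lia); rewrite ler_norml => /andP[+ _].
  have : 'C(m, d)%:R <= 'C(m + s, d)%:R :> R by rewrite ler_nat leq_bin2l // leq_addr.
  by nra.
have cm : c m <= (alpha' + 1) * 'C(m, d')%:R.
  by have := MP' m ltac:(rewrite /m; lia); rewrite ler_norml => /andP[_]; lra.
have C0 : 0 < 'C(m, d')%:R :> R by rewrite ltr0n bin_gt0 /m; lia.
have grow : (M2%:R + 1) * 'C(m, d')%:R <= d%:R * 'C(m, d)%:R :> R.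
  have [d1 dE] : exists d1, d = d1.+1 by exists d.-1; lia.
  rewrite natr1 -!natrM ler_nat dE mul_bin_left leq_mul //; first by rewrite /m; lia.
  by rewrite leq_bin2 /m; lia.
have M2P' : K * (alpha' + 1) * d%:R + 1 <= M2%:R * (alpha / 2).
  by have := M2P M2 (leqnn _); rewrite ler_pdivrMr // divr_gt0.
have := le_bc m; have : K * c m <= K * ((alpha' + 1) * 'C(m, d')%:R) by rewrite ler_wpM2l.
have d0 : 0 < d%:R :> R by rewrite ltr0n; lia.
nra.
Qed.

End BinomialAsymptotics.

(** * Orbits of nonnegative matrices *)

Section ComplexReal.
Local Open Scope classical_set_scope.
Local Open Scope ring_scope.
Local Open Scope complex_scope.
Variable R : realType.

Lemma ge0_complexE (x : R[i]) : 0 <= x -> x = (complex.Re x)%:C.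
Proof. by case: x => a b; rewrite lecE /= => /andP[/eqP ->]. Qed.

Lemma normc_realE (x : R[i]) : `|x| = (complex.Re `|x|)%:C.
Proof. exact: ge0_complexE. Qed.

Lemma Re_norm_ge0 (x : R[i]) : 0 <= complex.Re `|x|.
Proof. by have := normr_ge0 x; rewrite {1}normc_realE -[0]/(0%:C) lecR. Qed.

Lemma Re_norm_gt0 (x : R[i]) : (0 < complex.Re `|x|) = (x != 0).
Proof. by rewrite -normr_gt0 [in RHS]normc_realE -[0 in RHS]/(0%:C) ltcR. Qed.

Lemma exp_bounded_complex (eta : R) (c : nat -> R) :
  exp_bounded eta%:C (fun n => (c n)%:C) -> exp_bounded eta c.
Proof.
case=> K K0 cK; exists (complex.Re K).
  by move: K0; rewrite lecE => /andP[].
move=> n; rewrite -lecR; have := cK n; rewrite {1}(ge0_complexE K0).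
by rewrite normc_def /= expr0n addr0 sqrtr_sqr !rmorphM rmorphXn.
Qed.

Lemma all_lt1_bound (s : seq R[i]) :
  all (fun x => `|x| < 1) s -> exists2 eta : R, 0 <= eta < 1 & all (fun x => `|x| < eta%:C) s.
Proof.
elim: s => [|x s IH] /=; first by exists 0; rewrite ?lexx ?ltr01.
move=> /andP[x1 /IH[eta /andP[eta0 eta1] lt_s]].
pose y := complex.Re `|x|; have y1 : y < 1 by rewrite -ltcR -normc_realE.
have y0 : 0 <= y by exact: Re_norm_ge0.
pose z := Num.max ((y + 1) / 2) eta; exists z.
  by rewrite /z le_max eta0 orbT gt_max eta1 andbT; lra.
rewrite normc_realE ltcR lt_max; apply/andP; split; first by apply/orP; left; rewrite -/y; lra.
apply/allP => u /(allP lt_s) lt_u; apply: lt_le_trans lt_u _.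
by rewrite lecR le_max lexx orbT.
Qed.

Lemma max_norm (s : seq R[i]) : s != [::] ->
  exists2 mu, mu \in s & all (fun nu => `|nu| <= `|mu|) s.
Proof.
elim: s => // x [|y s] IH _; first by exists x; rewrite /= ?mem_head ?lexx.
have [//|mu mu_s le_s] := IH; have [le_xmu|lt_mux] := leP (complex.Re `|x|) (complex.Re `|mu|).
  exists mu; first by rewrite in_cons mu_s orbT.
  apply/allP => u; rewrite in_cons => /predU1P[->|/(allP le_s)//].
  by rewrite normc_realE [leRHS]normc_realE lecR.
exists x; first exact: mem_head.
apply/allP => u; rewrite in_cons => /predU1P[->//|/(allP le_s)/le_trans]; apply.
by rewrite normc_realE [leRHS]normc_realE lecR ltW.
Qed.

End ComplexReal.

Section NonnegativeOrbit.
Local Open Scope classical_set_scope.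
Local Open Scope ring_scope.
Local Open Scope complex_scope.
Variables (R : realType) (N : nat) (A : 'M[R]_N.+1) (x : nat -> 'rV[R]_N.+1).
Hypothesis A_ge0 : forall i j, 0 <= A i j.
Hypothesis x_ge0 : forall n i, 0 <= x n 0 i.
Hypothesis xS : forall n, x n.+1 = x n *m A.
Hypothesis reachable : forall i, exists n, 0 < x n 0 i.
Let a n := \sum_i x n 0 i.
Hypothesis a_neq0 : forall n, a n != 0.

Lemma orbit_power m n : x (m + n) = x m *m A ^+ n.
Proof.
elim: n => [|n IH]; first by rewrite addn0 mulmx1.
by rewrite addnS xS IH -mulmxA; congr (_ *m _); rewrite exprSr.
Qed.

Lemma orbit_sum_gt0 n : 0 < a n.
Proof. by rewrite lt0r a_neq0 sumr_ge0. Qed.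

Lemma orbit_growth : exists2 B, 0 <= B & forall n, a n.+1 <= B * a n.
Proof.
exists (\sum_i \sum_j A i j); first by apply: sumr_ge0 => i _; apply: sumr_ge0.
move=> n; rewrite {1}/a; under eq_bigr do rewrite xS mxE.
rewrite exchange_big mulr_suml /=; apply: ler_sum => i _.
rewrite -mulr_sumr mulrC ler_wpM2l ?sumr_ge0 //.
by rewrite /a (bigD1 i) //= lerDl sumr_ge0.
Qed.

Lemma orbit_growth_power : exists2 B, 0 <= B & forall m n, a (m + n)%N <= B ^+ m * a n.
Proof.
have [B B0 aB] := orbit_growth; exists B => //; elim=> [|m IH] n; first by rewrite mul1r.
rewrite addSn exprS -mulrA; apply: le_trans (aB _) _.
by rewrite ler_wpM2l.
Qed.

(** State [i] has positive weight at time [m i], so [(A ^+ n) i j] is at most a constant times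
    [a (m i + n)], and bounded growth removes the delay [m i]. *)
Lemma power_le_orbit_sum : exists2 B, 0 <= B & forall n i j, (A ^+ n) i j <= B * a n.
Proof.
have [m mP] := boolp.choice reachable; have [B B0 aB] := orbit_growth_power.
have term0 k : 0 <= B ^+ m k / x (m k) 0 k by rewrite divr_ge0 // exprn_ge0.
exists (\sum_k B ^+ m k / x (m k) 0 k); first exact: sumr_ge0.
move=> n i j; apply: (@le_trans _ _ (B ^+ m i / x (m i) 0 i * a n)); last first.
  rewrite ler_wpM2r ?(ltW (orbit_sum_gt0 _)) // (bigD1 i) //= lerDl.
  by apply: sumr_ge0 => k _.
rewrite mulrAC ler_pdivlMr //; apply: le_trans (aB _ _).
apply: (@le_trans _ _ (x (m i + n)%N 0 j)); last first.
  by rewrite /a (bigD1 j) //= lerDl sumr_ge0.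
rewrite orbit_power mxE mulrC (bigD1 i) //= lerDl sumr_ge0 // => k _.
by rewrite mulr_ge0 // mx_power_ge0.
Qed.

Local Notation C := R[i].
Let AC : 'M[C]_N.+1 := map_mx (real_complex R) A.

Lemma mapC_power n i j : (AC ^+ n) i j = ((A ^+ n) i j)%:C.
Proof.
have -> : AC ^+ n = map_mx (real_complex R) (A ^+ n) by rewrite rmorphXn.
by rewrite mxE.
Qed.

(** An entry of [v *m AC ^+ n = mu ^+ n *: v] is bounded through the entries of [A ^+ n], hence by a
    multiple of [a n]. *)
Lemma eigenvalue_le_orbit_sum mu : eigenvalue AC mu ->
  exists2 kappa : R, 0 < kappa & forall n, kappa * complex.Re `|mu| ^+ n <= a n.
Proof.
case/eigenvalueP => v vA /rV0Pn[j vj]; have [B B0 powB] := power_le_orbit_sum.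
pose u i := complex.Re `|v 0 i|; have uE i : `|v 0 i| = (u i)%:C by exact: normc_realE.
have u0 i : 0 <= u i by exact: Re_norm_ge0.
have uj : 0 < u j by rewrite Re_norm_gt0.
have vAn n : v *m AC ^+ n = mu ^+ n *: v.
  elim: n => [|n IH]; first by rewrite mulmx1 scale1r.
  have -> : AC ^+ n.+1 = AC ^+ n *m AC by rewrite exprSr.
  by rewrite mulmxA IH -scalemxAl vA scalerA exprSr.
have bound n : complex.Re `|mu| ^+ n * u j <= (\sum_i u i * B) * a n.
  rewrite -lecR rmorphM rmorphXn /= -normc_realE -uE -normrX -normrM.
  have -> : mu ^+ n * v 0 j = (v *m AC ^+ n) 0 j by rewrite vAn mxE.
  rewrite mxE mulr_suml rmorph_sum; apply: le_trans (ler_norm_sum _ _ _) _.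
  apply: ler_sum => i _; rewrite normrM mapC_power uE.
  rewrite [ `|_%:C|]ger0_norm; last by rewrite -[0]/(0%:C) lecR mx_power_ge0.
  by rewrite -rmorphM lecR -mulrA ler_wpM2l.
have D0 : 0 < \sum_i u i * B + 1 by rewrite ltr_wpDl // sumr_ge0 // => i _; rewrite mulr_ge0.
exists (u j / (\sum_i u i * B + 1)); first by rewrite divr_gt0.
move=> n; rewrite mulrAC ler_pdivrMr // mulrC [a n * _]mulrC; apply: le_trans (bound n) _.
by rewrite ler_wpM2r ?lerDl ?(ltW (orbit_sum_gt0 _)).
Qed.

Lemma orbit_dominant : exists (P : nat) (lambda : R), [/\ (0 < P)%N, 0 < lambda,
    exists2 kappa : R, 0 < kappa & forall n, kappa * lambda ^+ n <= a n &
    forall J, exists D (eta : R), 0 <= eta < 1 /\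
      exp_bounded eta
        (foldr (@shift_sub R) (fun m => a (J + P * m)%N / lambda ^+ (P * m)) (nseq D 1))].
Proof.
have AC_ge0 i j : 0 <= AC i j by rewrite mxE -[0]/(0%:C) lecR.
have [rs /esym] := closed_field_poly_normal (char_poly AC).
rewrite (monicP (char_poly_monic AC)) scale1r => /esym charE.
have rs_neq0 : rs != [::].
  by apply/eqP => rs0; have := size_char_poly AC; rewrite charE rs0 big_nil size_poly1.
have [mu mu_rs le_rs] := max_norm rs_neq0.
have eig : eigenvalue AC mu by rewrite eigenvalue_root_char charE root_prod_XsubC.
pose lambda := complex.Re `|mu|; have lamE : `|mu| = lambda%:C by exact: normc_realE.
(* If 0 were the only eigenvalue, [A] would be nilpotent and [a] would vanish eventually. *)
have mu_neq0 : mu != 0.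
  apply/eqP => mu0; have all0 nu : nu \in rs -> nu = 0.
    by move=> /(allP le_rs); rewrite mu0 normr0 normr_le0 => /eqP.
  have prodE s : {in s, forall nu, nu = 0} -> \prod_(nu <- s) (AC - nu%:M) = AC ^+ size s.
    elim: s => [|u s IH] s0; first by rewrite big_nil.
    rewrite big_cons exprS IH => [|nu nu_s]; last by apply: s0; rewrite in_cons nu_s orbT.
    by rewrite (s0 u) ?mem_head // raddf0 subr0.
  have pow0 : A ^+ size rs = 0.
    apply/matrixP => i j; apply: complexI; rewrite -mapC_power -prodE //.
    by rewrite (prod_sub_eigenvalues_eq0 charE) !mxE.
  have /negP := a_neq0 (0 + size rs)%N; apply; apply/eqP; rewrite /a orbit_power pow0 mulmx0.
  by rewrite big1 // => i _; rewrite mxE.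
have lam0 : 0 < lambda by rewrite Re_norm_gt0.
pose P := (N.+1)`!.
have P_gt0 : (0 < P)%N by exact: fact_gt0.
have peripheral nu : nu \in rs -> nu ^+ P = (lambda ^+ P)%:C \/ `|nu| < lambda%:C.
  move=> nu_rs; have := allP le_rs nu nu_rs.
  rewrite le_eqVlt lamE => /predU1P[nuE|]; [left|by right].
  have [||p /andP[p0 le_p] nup] := peripheral_eigenvalue charE AC_ge0 nu_rs.
  - by rewrite -normr_eq0 nuE -lamE normr_eq0.
  - by apply/allP => k /(allP le_rs); rewrite nuE -lamE.
  have /dvdnP[q PE] : (p %| P)%N by rewrite dvdn_fact // p0.
  by rewrite PE mulnC exprM nup nuE -exprM rmorphXn.
exists P, lambda; split=> //; first exact: eigenvalue_le_orbit_sum.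
move=> J; pose rho nu := nu ^+ P / (lambda ^+ P)%:C.
have lamP0 : (lambda ^+ P)%:C != 0 by rewrite fmorph_eq0 expf_neq0 // gt_eqF.
pose small := [pred nu : C | `|nu| < lambda%:C].
pose B : 'M[C]_N.+1 := (lambda ^+ P)%:C^-1 *: AC ^+ P.
(* As ['X - nu] divides ['X^P - nu ^+ P], Cayley-Hamilton for [AC] makes the product of all
   [B - rho nu] vanish; the characteristic polynomial of [B] is never computed. *)
have factorB nu : exists q, B - (rho nu)%:M = horner_mx AC (('X - nu%:P) * q).
  exists ((lambda ^+ P)%:C^-1 *: \sum_(i < P) 'X^(P.-1 - i) * nu%:P ^+ i).
  rewrite -scalerAr -subrXX -polyC_exp linearZ /= rmorphB (rmorphXn (horner_mx AC)) /=.
  by rewrite horner_mx_X horner_mx_C scalerBr /B /rho mulrC scale_scalar_mx.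
have [q qP] := boolp.choice factorB.
(* The factors with [|rho nu| < 1] come first, hence act last, so [exp_bounded_foldr] strips them.
   Every remaining [rho nu] is 1, which leaves iterated differences. *)
pose rs' := [seq nu <- rs | small nu] ++ [seq nu <- rs | predC small nu].
have prod0 : \prod_(nu <- map rho rs') (B - nu%:M) = 0.
  rewrite big_map (eq_bigr _ (fun nu _ => qP nu)) -rmorph_prod.
  rewrite (perm_big rs) ?perm_filterC // big_split rmorphM /= -charE.
  by rewrite Cayley_Hamilton mul0r.
pose M : 'M[C]_N.+1 := \matrix_(i, k) (x J 0 k)%:C.
pose c m := a (J + P * m)%N / lambda ^+ (P * m).
have cE m : (c m)%:C = (M * B ^+ m * const_mx 1) 0 0.
  rewrite /B exprZn -exprM -scalerAr mxE /c /a mulr_suml rmorph_sum; apply: eq_bigr => j _.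
  rewrite orbit_power !mxE mulr1 mulrC rmorphM fmorphV exprVn exprM (rmorphXn _ m).
  congr (_^-1 * _); rewrite rmorph_sum; apply: eq_bigr => k _.
  by rewrite mxE mapC_power rmorphM.
have : foldr (@shift_sub C) (fun m => (M * B ^+ m * const_mx 1) 0 0) (map rho rs') =1 (fun=> 0).
  by move=> n; rewrite foldr_shift_sub_mx prod0 mulr0 mul0r mxE.
have -> : (fun m => (M * B ^+ m * const_mx 1) 0 0) = (fun m => (c m)%:C) by apply/funext => m.
rewrite map_cat foldr_cat; set b := foldr _ _ (map rho ([seq nu <- rs | predC small nu])) => b0.
have rho_small : all (fun nu => `|nu| < 1) (map rho ([seq nu <- rs | small nu])).
  apply/allP => z /mapP[nu]; rewrite mem_filter => /andP[/= lt_nu _] ->.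
  rewrite /rho normrM normfV normrX [ `|_%:C|]gtr0_norm; last by rewrite -[0]/(0%:C) ltcR exprn_gt0.
  rewrite ltr_pdivrMr ?mul1r; last by rewrite -[0]/(0%:C) ltcR exprn_gt0.
  by rewrite rmorphXn ltrXn2r // -lt0n.
have [eta eta01 lt_eta] := all_lt1_bound rho_small.
have bE : exp_bounded eta%:C b.
  by apply: exp_bounded_foldr lt_eta _; exists 0 => // n; rewrite b0 normr0 mul0r.
exists (size [seq nu <- rs | predC small nu]), eta; split=> //; apply: exp_bounded_complex.
have real_foldr D n : (foldr (@shift_sub R) c (nseq D 1) n)%:C =
    foldr (@shift_sub C) (fun m => (c m)%:C) (nseq D 1) n.
  by elim: D n => //= D IH n; rewrite /shift_sub -!IH !mul1r rmorphB.
have -> : (fun n => (foldr (@shift_sub R) c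
    (nseq (size [seq nu <- rs | predC small nu]) 1) n)%:C) = b.
  apply/funext => n; rewrite real_foldr /b; congr (foldr _ _ _ n).
  rewrite -(size_map rho); apply/esym/all_pred1P/allP => z /mapP[nu].
  rewrite mem_filter => /andP[/= large nu_rs] ->.
  have [|lt_nu] := peripheral nu nu_rs; last by rewrite lt_nu in large.
  by rewrite /rho /= => ->; rewrite divff.
exact: bE.
Qed.

Lemma orbit_ratio_cvg : exists2 P, (0 < P)%N & forall J k, (k <= J)%N ->
  exists y : R, (fun m => a (J - k + P * m)%N / a (J + P * m)%N) @ \oo --> y.
Proof.
have [P [lambda [P0 lam0 [kappa kappa0 lower] exp_diff]]] := orbit_dominant.
pose c J m := a (J + P * m)%N / lambda ^+ (P * m).
have lamX n : 0 < lambda ^+ n by rewrite exprn_gt0.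
have c_gt0 J m : 0 < c J m by rewrite divr_gt0 // orbit_sum_gt0.
have c_ge J m : kappa * lambda ^+ J <= c J m.
  by rewrite ler_pdivlMr // -mulrA -exprD lower.
have asy J : exists da : nat * R, 0 < da.2 /\ asymp_bin da.1 da.2 (c J).
  have [D [eta [eta01 diff]]] := exp_diff J.
  (* Exponential decay is excluded by the lower bound [c_ge]. *)
  have [[K K0 cK]|[d [alpha [alpha0 asy]]]] := asymp_bin_dichotomy eta01 diff.
    have pos : 0 < kappa * lambda ^+ J / 2 by rewrite divr_gt0 ?mulr_gt0.
    have [M /(_ M (leqnn M)) le_half] := exp_le_eventually K eta01 pos.
    have := le_trans (c_ge J M) (le_trans (ler_norm _) (le_trans (cK M) le_half)).
    by move: pos; lra.
  by exists (d, alpha); split=> //; apply: asymp_bin_gt0 asy => // m; exact: ltW (c_gt0 J m).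
have [da daP] := boolp.choice asy; have [B B0 aB] := orbit_growth.
(* Bounded growth makes the degree nonincreasing in [J], while the sequence for [J + P] is, up to a
   factor, a translate of the one for [J]; the degree is therefore constant. *)
have dS J : ((da J.+1).1 <= (da J).1)%N.
  have [pos asy1] := daP J.+1; have [_ asy0] := daP J.
  apply: (asymp_bin_le (s := 0) pos asy1 asy0 _ B0) => m.
  by rewrite addn0 /c mulrA ler_wpM2r ?invr_ge0 ?(ltW (lamX _)) // addSn.
have dP J : ((da J).1 <= (da (J + P)%N).1)%N.
  have [pos asy0] := daP J; have [_ asy1] := daP (J + P)%N.
  apply: (asymp_bin_le (s := 1) pos asy0 asy1 _ (ltW (_ : 0 < (lambda ^+ P)^-1))) => [m|].
    by rewrite /c addn1 mulnS addnA exprD invfM mulrCA.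
  by rewrite invr_gt0.
have d_mono J i : ((da (J + i)%N).1 <= (da J).1)%N.
  by elim: i => [|i IH]; rewrite ?addn0 // addnS (leq_trans (dS _)).
have d_const J : (da J).1 = (da 0).1.
  elim: J => // J <-; apply/eqP; rewrite eqn_leq dS /=; apply: leq_trans (dP J) _.
  by rewrite -(prednK P0) -addSnnS d_mono.
exists P => // J k le_kJ; exists ((da (J - k)%N).2 / (da J).2).
have [_] := daP (J - k)%N; rewrite d_const => asyk.
have [pos] := daP J; rewrite d_const => asyJ.
apply: cvg_trans (asymp_bin_ratio (lt0r_neq0 pos) asyk asyJ).
apply: near_eq_cvg; exists 0%N => // m _; rewrite /c invfM invrK mulrACA mulVf ?mulr1 //.
by rewrite gt_eqF.
Qed.

End NonnegativeOrbit.

(** * Opposite series *)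

Section Cluster.
Local Open Scope classical_set_scope.
Local Open Scope ring_scope.
Variable R : realType.

(** A point [z] other than all the [y j] differs from each in some coordinate [k j]; a neighbourhood
    of [z] given by these finitely many coordinates avoids a tail of [u]. *)
Lemma cluster_residue_classes (u : nat -> {ptws nat -> R}) P (y : nat -> {ptws nat -> R}) :
  (0 < P)%N -> (forall j k, (fun m => u (j + P * m)%N k) @ \oo --> y j k) ->
  cluster (u n @[n --> \oo]) `<=` y @` `I_P.
Proof.
move=> P0 u_cvg z clz; apply: contrapT => z_notin.
have /boolp.choice[k kP] : forall j : 'I_P, exists k, y j k != z k.
  move=> j; apply: contrapT => none; apply: z_notin; exists (j : nat); first by rewrite /=.
  by apply/funext => k; apply/eqP/negPn/negP => neq; apply: none; exists k.
pose e (j : 'I_P) := `|y j (k j) - z (k j)| / 2.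
have e0 j : 0 < e j by rewrite divr_gt0 // normr_gt0 subr_eq0.
have near_y : \forall n \near \oo,
    forall j : 'I_P, (n %% P)%N = j -> `|y j (k j) - u n (k j)| < e j.
  apply: filter_forall => j; have /cvgrPdist_lt/(_ _ (e0 j))[M _ MP] := u_cvg j (k j).
  exists (P * M)%N => // n /= le_n nj.
  have nE : n = (j + P * (n %/ P))%N by rewrite {1}(divn_eq n P) nj addnC mulnC.
  by have := MP (n %/ P)%N; rewrite /= leq_divRL // mulnC le_n -nE; apply.
have near_z : \forall w \near z, forall j : 'I_P, `|z (k j) - w (k j)| < e j.
  apply: (@filter_forall _ _ (fun j w => `|z (k j) - w (k j)| < e j) _ (nbhs_filter z)) => j.
  have eval_cvg : (fun w : {ptws nat -> R} => w (k j)) @ z --> z (k j).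
    exact: (@proj_continuous nat (fun=> R : topologicalType) (k j) z).
  by move/cvgrPdist_lt : eval_cvg => /(_ _ (e0 j)).
have [|_ [[n near_n <-] near_un]] := clz (u @` [set n | forall j : 'I_P,
    (n %% P)%N = j -> `|y j (k j) - u n (k j)| < e j]) _ _ near_z.
  by apply: filterS near_y => n near_n; exists n.
pose j := Ordinal (ltn_pmod n P0).
have := near_n j erefl; have := near_un j; have := e0 j; rewrite /e.
have := ler_distD (u n (k j)) (y j (k j)) (z (k j)); rewrite (distrC (u n (k j))).
lra.
Qed.

End Cluster.

Section HyperbolicGrowth.
Local Open Scope classical_set_scope.
Local Open Scope ring_scope.
Variables (R : realType) (G : groupType).

(** Clearing the halves in the Gromov products doubles [delta], and [D] is a natural number above
    [2 * delta]. *)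
Lemma hyperbolic_four_point (S : set G) :
  gromov_hyperbolic (fun g h : G => (word_dist S g h)%:R : R) ->
  exists D, forall p x y z : G,
    (word_dist S x z + word_dist S y p <= maxn (word_dist S x y + word_dist S z p)
       (word_dist S y z + word_dist S x p) + D)%N.
Proof.
move=> [delta deltaP]; have [D DP] := nat_unbounded (2 * delta).
exists D => p x y z; have := deltaP p x y z; rewrite /gromov_product lerBlDr => hyp.
have {}DP := DP D (leqnn D); move: hyp; rewrite ge_min => /orP[] hyp.
  apply: leq_trans (leq_add (leq_maxl _ _) (leqnn D)).
  by rewrite -(ler_nat R) !natrD; lra.
apply: leq_trans (leq_add (leq_maxr _ _) (leqnn D)).
by rewrite -(ler_nat R) !natrD; lra.
Qed.

Lemma hyperbolic_growth_transfer (S : set G) :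
  word_hyperbolic R G -> finite_set S -> generating S ->
  exists N (A : 'M[R]_N.+1) (x : nat -> 'rV[R]_N.+1),
    [/\ forall i j, 0 <= A i j, forall n i, 0 <= x n 0 i,
        forall n, x n.+1 = x n *m A, forall i, exists n, 0 < x n 0 i &
        forall n, growth_series R S n = \sum_i x n 0 i].
Proof.
move=> [S0 [finS0 genS0 /hyperbolic_four_point[D four_point]]] finS genS.
have [K fellow] := fellow_traveler finS0 genS0 finS genS four_point.
exact: (@growth_transfer R _ _ finS genS _ fellow).
Qed.

End HyperbolicGrowth.

Local Open Scope classical_set_scope.
Local Open Scope ring_scope.

Theorem corollary5p4 (R : realType) (G : groupType) (S : set G)
    (hypG : word_hyperbolic R G) (finS : finite_set S) (genS : generating S) :
  finite_set (opposite_series (growth_series R S)).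
Proof.
have [N [A [x [A_ge0 x_ge0 xS reach aE]]]] := hyperbolic_growth_transfer hypG finS genS.
set a := growth_series R S in aE *.
have aEx n : a n = \sum_i x n 0 i by exact: aE.
suff [P [y [P0 y_cvg]]] : exists P (y : nat -> {ptws nat -> R}), (0 < P)%N /\
    forall j k, (fun m => opposite_seq a (j + P * m)%N k) @ \oo --> y j k.
  by apply: sub_finite_set (cluster_residue_classes P0 y_cvg) _; exact: finite_image.
have [a_neq0|/existsNP[n0 /negP/negPn/eqP an0]] := pselect (forall n, a n != 0).
  have [|P P0 ratio] := orbit_ratio_cvg A_ge0 x_ge0 xS reach; first by move=> n; rewrite -aEx.
  have lim j k : exists l : R, (fun m => opposite_seq a (j + P * m)%N k) @ \oo --> l.
    (* Starting at [j + P * k] keeps the subtraction of [k] from being truncated; shifting [m] by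
       [k] does not affect the limit. *)
    have [|l lP] := ratio (j + P * k)%N k; first by nia.
    exists l; rewrite -(cvg_shiftn k); apply: cvg_trans lP; apply: near_eq_cvg.
    exists 0%N => // m _; rewrite /= /opposite_seq coef_poly ifT; last by nia.
    rewrite -!aEx; congr (a _ / a _); nia.
  exists P, (fun j => projT1 (boolp.choice (lim j))); split=> // j k.
  exact: projT2 (boolp.choice (lim j)) k.
(* Once a sphere is empty all later ones are, and [opposite_seq] is eventually 0 because
   [x / 0 = 0]; one class with limit 0 suffices. *)
have x0 n : (n0 <= n)%N -> x n = 0.
  move=> /subnKC <-; elim: (n - n0)%N => [|m IH]; last by rewrite addnS xS IH mul0mx.
  apply/rowP => i; rewrite addn0 mxE; move/eqP: an0; rewrite aEx psumr_eq0 //.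
  by move=> /allP/(_ i (mem_index_enum _))/eqP.
exists 1%N, (fun _ _ => 0); split=> // j k; apply: cvg_near_cst.
exists n0 => // m /= le_m; rewrite /opposite_seq coef_poly.
have -> : a (j + 1 * m)%N = 0 by rewrite aEx x0 ?big1 // => [i _|]; [rewrite mxE|lia].
by rewrite invr0 mulr0; case: ifP.
Qed.
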